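(* Let $d=1$ and suppose the weight vector $w$ and the noise $\xi$ satisfy assumptions (W1), (X) and (W2) of the context. Let $\nu$ be a probability measure on $\mathbb R^{\mathbb Z}$ that is invariant for the increment process $\eta_t$, shift invariant, and ergodic under spatial shifts, and suppose $\mathbb E^\nu|\eta(0)|<\infty$ and $\mathbb E^\nu[\eta(0)]=c$. Let $\pi_c$ denote the distribution of $\{c+\Delta_0(x)\}_{x\in\mathbb Z}$. Then $$\nu=\pi_c.$$
   Context: $\mathbb Z^+$ is the set of nonnegative integers. (W1): $w=\{w(k)\}_{k\in\mathbb Z}$ satisfies $0\le w(k)<1$ for all $k$, $\sum_k w(k)=1$, and $\mathrm{supp}(w)=\{k: w(k)>0\}$ is finite. (W2) (span 1): $\max\{k\in\mathbb Z^+ : \exists \ell\in\mathbb Z \text{ with } \mathrm{supp}(w)\subset \ell+k\mathbb Z\}=1$. (X): $\{\xi_t(k)\}_{k\in\mathbb Z,t\in\mathbb Z}$ are i.i.d. real random variables with mean zero and variance $\sigma_\xi^2<\infty$. The increment process evolves by $$\eta_{t+1}(i)=\sum_{k\in\mathbb Z}w(k)\eta_t(i+k)+\xi_{t+1}(i)-\xi_{t+1}(i-1),\quad i\in\mathbb Z,\ t\in\mathbb Z^+,$$ with $\eta_0$ independent of $\{\xi_k(i)\}_{k\ge 1,i\in\mathbb Z}$. A probability measure $\nu$ on $\mathbb R^{\mathbb Z}$ is invariant for $\eta_t$ if $\eta_0\sim\nu$ implies $\eta_1\sim\nu$. $\mathbb E^\nu$ is expectation when $\eta=\{\eta(x)\}_{x\in\mathbb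 Z}$ has law $\nu$. The shifts are $(\theta_x\eta)(i)=\eta(i+x)$. $\nu$ is shift invariant if $\nu(\theta_xA)=\nu(A)$ for all Borel $A$ and $x\in\mathbb Z$; a shift-invariant $\nu$ is ergodic if $\nu(B)\in\{0,1\}$ for every Borel $B$ with $\theta_xB=B$ for all $x\in\mathbb Z$. Let $p(i,j)=w(j-i)$ with multistep transition probabilities $p^k$, $p^0(i,j)=\mathbf 1\{i=j\}$. The sequence $\Delta_0$ is $$\Delta_0(i)=\sum_{j\in\mathbb Z}\sum_{k=0}^\infty\xi_{-k}(j)\left[p^k(i,j)-p^k(i-1,j)\right],\quad i\in\mathbb Z,$$ understood as the almost sure and $L^2$ limit, as $s\to\infty$, of $\sum_{k=0}^{s-1}\sum_{j\in\mathbb Z}\xi_{-k}(j)[p^k(i,j)-p^k(i-1,j)]$ (this limit exists). *)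

(* Defs.v *)
From HB Require Import structures.
From mathcomp Require Import all_boot all_order all_algebra finmap.
From mathcomp Require Import all_classical all_reals all_analysis.

Set Implicit Arguments.
Unset Strict Implicit.
Unset Printing Implicit Defensive.

Import Order.TTheory GRing.Theory Num.Theory.
Import numFieldNormedType.Exports.

Local Open Scope classical_set_scope.
Local Open Scope ring_scope.

(* R^Z with the Borel sigma-algebra of the product topology. *)
Definition RZ (R : realType) := g_sigma_algebraType (@open {ptws int -> R}).

Section Weights.
Variables (R : realType) (w : int -> R).

Definition supp : set int := [set k | 0 < w k].

(* [\sum_(k \in _)] sums over the indices with nonzero terms, which are
   finitely many by the third clause. *)
Definition W1 : Prop :=
  [/\ forall k, 0 <= w k < 1,
      \sum_(k \in [set: int]) w k = 1
    & finite_set supp].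

Definition span_set : set nat :=
  [set k : nat | exists l : int, supp `<=` [set l + k%:Z * m | m in [set: int]]].

(* The maximum of [span_set] is 1. *)
Definition W2 : Prop := span_set 1%N /\ ubound span_set 1%N.

(* p^n(i,j), with one-step probabilities p(i,j) = w(j - i). *)
Fixpoint pstep (n : nat) (i j : int) : R :=
  if n is m.+1 then \sum_(l \in [set: int]) w (l - i) * pstep m l j
  else (i == j)%:R.

End Weights.

Section Noise.
Context d (Om : measurableType d) (R : realType) (P : probability Om R).

Definition mutually_independent (I : choiceType) (X : I -> {RV P >-> R}) : Prop :=
  forall (J : {fset I}) (B : I -> set R),
    (forall i, measurable (B i)) ->
    (P (\bigcap_(i in [set` J]) X i @^-1` B i) =
     \prod_(i <- J) P (X i @^-1` B i))%E.

(* [xi t k] is the noise variable at time t and site k. *)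
Definition iid (xi : int -> int -> {RV P >-> R}) : Prop :=
  mutually_independent (fun tk : int * int => xi tk.1 tk.2) /\
  forall (t k : int) (B : set R), measurable B ->
    distribution P (xi t k) B = distribution P (xi 0 0) B.

Definition assumption_X (xi : int -> int -> {RV P >-> R}) : Prop :=
  iid xi /\
  forall t k : int,
    [/\ (xi t k : Om -> R) \in Lfun P 1,
        ('E_P[xi t k] = 0)%E
      & ('V_P[xi t k] < +oo)%E].

(* sigma-algebra generated by xi_k(i), k >= 1, i in Z. *)
Definition future_sigma (xi : int -> int -> {RV P >-> R}) : set (set Om) :=
  <<s [set F | exists k i : int, exists B : set R,
         [/\ 1 <= k, measurable B & F = xi k i @^-1` B] ] >>.

Definition independent_of_noise
    (eta0 : {RV P >-> RZ R}) (xi : int -> int -> {RV P >-> R}) : Prop :=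
  forall (A : set (RZ R)) (F : set Om), measurable A -> future_sigma xi F ->
    (P ((eta0 @^-1` A) `&` F) = P (eta0 @^-1` A) * P F)%E.

End Noise.

(* The process eta_t(i) started from eta_0; the sum is finite under W1. *)
Fixpoint increment (Om : Type) (R : realType) (w : int -> R)
    (xi : int -> int -> Om -> R) (eta0 : Om -> RZ R) (t : nat) (om : Om) : RZ R :=
  if t is s.+1 then fun i : int =>
    \sum_(k \in [set: int]) w k * increment w xi eta0 s om (i + k)
    + xi s.+1%:Z i om - xi s.+1%:Z (i - 1) om
  else eta0 om.

(* Invariance refers to the process driven by i.i.d. noise distributed as
   [xi]; it is required for every probability space carrying such noise
   together with an independent initial state of law [nu]. *)
Definition invariant_measure d (Om : measurableType d) (R : realType)
    (P : probability Om R) (w : int -> R) (xi : int -> int -> {RV P >-> R})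
    (nu : probability (RZ R) R) : Prop :=
  forall d' (Om' : measurableType d') (P' : probability Om' R)
    (xi' : int -> int -> {RV P' >-> R}) (eta0 : {RV P' >-> RZ R}),
    iid xi' ->
    (forall B : set R, measurable B ->
       distribution P' (xi' 0 0) B = distribution P (xi 0 0) B) ->
    independent_of_noise eta0 xi' ->
    (forall A : set (RZ R), measurable A -> distribution P' eta0 A = nu A) ->
    forall A : set (RZ R), measurable A ->
      pushforward P' (increment w (fun t i => xi' t i) eta0 1) A = nu A.

Section Shifts.
Variable R : realType.

Definition theta (x : int) (eta : RZ R) : RZ R := fun i : int => eta (i + x).

Definition shift_invariant (nu : probability (RZ R) R) : Prop :=
  forall (A : set (RZ R)) (x : int), measurable A -> nu (theta x @` A) = nu A.

Definition shift_ergodic (nu : probability (RZ R) R) : Prop :=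
  forall B : set (RZ R), measurable B -> (forall x : int, theta x @` B = B) ->
    nu B = 0%E \/ nu B = 1%E.

End Shifts.

Section Delta0.
Context d (Om : measurableType d) (R : realType) (P : probability Om R).
Variables (w : int -> R) (xi : int -> int -> {RV P >-> R}).

Definition Delta0_partial (s : nat) (i : int) (om : Om) : R :=
  \sum_(0 <= k < s) \sum_(j \in [set: int])
    xi (- k%:Z) j om * (pstep w k i j - pstep w k (i - 1) j).

(* [D] is a version of Delta_0, i.e. the almost sure and L^2 limit of the
   partial sums. *)
Definition is_Delta0 (D : int -> {RV P >-> R}) : Prop :=
  forall i : int,
    {ae P, forall om, Delta0_partial s i om @[s --> \oo] --> D i om} /\
    ('E_P[fun om => ((Delta0_partial s i om - D i om) ^+ 2)%R])%E @[s --> \oo] --> 0%E.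

(* The law of {c + D(x)}_{x in Z}. *)
Definition pi_ (D : int -> {RV P >-> R}) (c : R) : set (RZ R) -> \bar R :=
  pushforward P (fun om => (fun x : int => c + D x om) : RZ R).

End Delta0.

(* Main.v *)
(* Start the process at time -s from a configuration eta of law nu, independent
   of the noise, and run it up to time 0.  By invariance the law stays nu, and
   since the dynamics are linear the configuration at time 0 is
     sum_j p^s(i, j) eta(j) + Delta0_partial s i.
   The second term converges to Delta_0, so it suffices that the first one tends
   to c in L^1(nu).  Let A be averaging over the shifts with weights w.  For
   bounded g, the identity
     E (A g)^2 + sum_k w(k) E (g o theta_k - A g)^2 = E g^2
   shows that A^t g o theta_k - A^t g o theta_l -> 0 in L^2 for k, l in the support
   of w.  The x for which A^t g o theta_x - A^t g -> 0 form a subgroup of Z, which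
   is all of Z by the span condition.  Hence A^t g is close to the Birkhoff
   average of A^t g, which is A^t applied to the Birkhoff average of g, and the
   latter is L^1-close to E g by the maximal ergodic argument and ergodicity. *)

Require Import Defs.
From HB Require Import structures.
From mathcomp Require Import all_boot all_order all_algebra finmap.
From mathcomp Require Import all_classical all_reals all_analysis.
From mathcomp Require Import measurable_realfun.
From mathcomp Require Import ring lra.

Set Implicit Arguments.
Unset Strict Implicit.
Unset Printing Implicit Defensive.

Import Order.TTheory GRing.Theory Num.Theory.
Import numFieldNormedType.Exports.

Local Open Scope classical_set_scope.
Local Open Scope ring_scope.

(** * The Borel sets of R^Z *)

Section rz.
Variable R : realType.

(** Rational endpoints make the boxes a countable family, so that an open set is a countable union
    of them. *)
Definition box (s : seq (int * (rat * rat))) : set (RZ R) :=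
  [set eta | forall t, t \in s -> ratr t.2.1 < eta t.1 < ratr t.2.2].

Lemma nbhs_box (U : set {ptws int -> R}) (eta : {ptws int -> R}) :
  nbhs eta U -> exists2 s, box s eta & box s `<=` U.
Proof.
pose F : set_system {ptws int -> R} := filter_from [set s | box s eta] box.
have FF : Filter F.
  apply: filter_from_filter; first by exists [::].
  move=> s s' /= bs bs'; exists (s ++ s').
    by move=> t; rewrite mem_cat => /orP[/bs|/bs'].
  move=> z bz; split => t ts; apply: bz; rewrite mem_cat ts ?orbT//.
(* The product topology is a supremum of topologies, so convergence of the filter of boxes can be
   tested one coordinate at a time. *)
suff : F --> eta by move=> /(_ U) h /h[s]; exists s.
apply/cvg_sup => i V [_ [[W oW <-] We WV]].
have [e /= e0 eW] : nbhs (eta i) W by exact: open_nbhs_nbhs.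
have /rat_in_itvoo[a] : eta i - e < eta i by rewrite ltrBlDr ltrDl.
rewrite in_itv/= => /andP[a1 a2].
have /rat_in_itvoo[b] : eta i < eta i + e by rewrite ltrDl.
rewrite in_itv/= => /andP[b1 b2].
exists [:: (i, (a, b))] => /= [t|z bz]; first by rewrite inE => /eqP -> /=; apply/andP.
apply: WV => /=; apply: eW => /=.
have /andP[/= az zb] := bz _ (mem_head _ _).
by rewrite ltr_distlC; apply/andP; split;
  [exact: (lt_trans a1 az)|exact: (lt_trans zb b2)].
Qed.

Lemma measurable_RZ d (T : measurableType d) (f : T -> RZ R) :
  (forall i, measurable_fun setT (fun x => f x i : R)) -> measurable_fun setT f.
Proof.
move=> mf; apply: (@measurability _ _ _ _ setT f (@open {ptws int -> R}) erefl).
move=> _ [U oU <-]; rewrite setTI.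
have -> : U = \bigcup_s (if `[< box s `<=` U >] then box s else set0).
  apply/seteqP; split => [x Ux|x [s _]].
    have [s bs bU] := nbhs_box (open_nbhs_nbhs (conj oU Ux)).
    by exists s => //; case: asboolP.
  by case: asboolP => // h; exact: h.
rewrite preimage_bigcup; apply: countable_bigcupT_measurable => // s.
case: asboolP => [_|_]; last by rewrite preimage_set0.
elim: s => [|t s IH].
  by rewrite (_ : _ @^-1` _ = setT)//; apply/seteqP; split => // x _ u.
rewrite (_ : _ @^-1` _ = (fun x => f x t.1) @^-1` `]ratr t.2.1, ratr t.2.2[ `&`
    f @^-1` box s).
  by apply: measurableI => //; rewrite -[X in measurable X]setTI; exact: mf.
apply/seteqP; split => [x xs|x [xt xs] u].
  split; first by rewrite /= in_itv/= xs ?mem_head.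
  by move=> u us; apply: xs; rewrite inE us orbT.
rewrite inE => /orP[/eqP ->|]; last exact: xs.
by move: xt; rewrite /= in_itv.
Qed.

Lemma measurable_coord i : measurable_fun setT (fun eta : RZ R => eta i : R).
Proof.
apply: (measurability _ (RGenOInfty.measurableE R)) => _ [_ [x ->]] <-.
rewrite setTI; apply: sub_sigma_algebra => /=.
apply: (@open_comp {ptws int -> R} R (fun eta => eta i)) => [eta _|].
  exact: (@proj_continuous int (fun=> R) i).
rewrite set_itv_o_infty; exact: open_gt.
Qed.

Lemma measurable_RZP d (T : measurableType d) (f : T -> RZ R) :
  measurable_fun setT f <-> forall i, measurable_fun setT (fun x => f x i : R).
Proof.
split => [mf i|]; last exact: measurable_RZ.
exact: (measurableT_comp (measurable_coord i)).
Qed.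

(** The probabilities of these events are the finite-dimensional distribution functions. A site may
    occur repeatedly in [s], so concatenation gives intersections. *)
Definition orthant (s : seq (int * R)) : set (RZ R) :=
  [set eta | forall t, t \in s -> eta t.1 <= t.2].

Lemma measurable_orthant s : measurable (orthant s).
Proof.
elim: s => [|t s IH].
  by rewrite (_ : orthant _ = setT)//; apply/seteqP; split => // x _ u.
rewrite (_ : orthant _ = (fun x : RZ R => x t.1) @^-1` `]-oo, t.2] `&` orthant s).
  apply: measurableI => //; rewrite -[X in measurable X]setTI.
  exact: measurable_coord.
apply/seteqP; split => [x xs|x [xt xs] u].
  split; first by rewrite /= in_itv/= xs ?mem_head.
  by move=> u us; apply: xs; rewrite inE us orbT.
rewrite inE => /orP[/eqP ->|]; last exact: xs.
by move: xt; rewrite /= in_itv.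
Qed.

(** The orthants form a pi-system, and they generate the Borel sets: the coordinates are measurable
    for the sigma-algebra they generate, hence so is the identity map into [RZ R]. *)
Lemma orthant_unique (m1 m2 : {measure set (RZ R) -> \bar R}) :
  (m1 setT < +oo)%E -> (forall s, m1 (orthant s) = m2 (orthant s)) ->
  forall A, measurable A -> m1 A = m2 A.
Proof.
move=> m1fin m12 A mA.
have orthantT : orthant [::] = setT by apply/seteqP; split => // x _ u.
apply: (measure_unique [set B | exists s, B = orthant s] (fun=> setT)) => //.
- apply/seteqP; split; last first.
    apply: smallest_sub => [|_ [s ->]]; last exact: measurable_orthant.
    exact: sigma_algebra_measurable.
  pose T' : measurableType _ :=
    g_sigma_algebraType [set B : set (RZ R) | exists s, B = orthant s].
  have mid : measurable_fun setT (id : T' -> RZ R).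
    apply: measurable_RZ => i.
    apply: (measurability _ (RGenOInfty.measurableE R)) => _ [_ [x ->]] <-.
    rewrite setTI -setCitvl preimage_setC; apply: measurableC.
    apply: sub_sigma_algebra; exists [:: (i, x)]; apply/seteqP; split => [z|z zx].
      by rewrite /= in_itv/= => zx t; rewrite inE => /eqP ->.
    by rewrite /= in_itv/= (zx _ (mem_head _ _)).
  by move=> B mB; have := mid measurableT B mB; rewrite setTI.
- move=> _ _ [s ->] [s' ->]; exists (s ++ s'); apply/seteqP; split => [x [xs xs'] t|x xs].
    by rewrite mem_cat => /orP[/xs|/xs'].
  by split => t ts; apply: xs; rewrite mem_cat ts ?orbT.
- by move=> _; exists [::]; rewrite orthantT.
- by rewrite bigcup_const.
- by move=> _ [s ->].
Qed.

End rz.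

(** * Independence *)

Section independence.
Context d (Om : measurableType d) (R : realType) (P : probability Om R).

(** As functions of [A], both sides are finite measures, and they agree on the pi-system [G]. *)
Lemma indep_g_sigma (G : set (set Om)) (C : set Om) :
  measurable C -> G `<=` measurable -> setI_closed G -> G setT ->
  (forall A, G A -> P (C `&` A) = (P C * P A)%E) ->
  forall A, <<s G >> A -> P (C `&` A) = (P C * P A)%E.
Proof.
move=> mC Gm GI GT h A sA.
have PCf : P C \is a fin_num by exact: fin_num_measure.
have PC0 : 0 <= fine (P C) by exact: fine_ge0.
rewrite setIC -(fineK PCf).
apply: (@g_sigma_algebra_measure_unique _ R _ G Gm (fun=> setT) _ _
  (mrestr P mC) (mscale (NngNum PC0) P)) => //=.
- by rewrite bigcup_const.
- by move=> B GB; rewrite /mrestr /mscale/= setIC h// fineK.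
- by move=> _; rewrite /mrestr setTI ltey_eq PCf.
Qed.

Context (I : choiceType) (X : I -> {RV P >-> R}).

Definition gens (J : set I) : set (set Om) :=
  [set F | exists i, exists B : set R, [/\ J i, measurable B & F = X i @^-1` B]].

(** Requiring [B i = setT] off [K] lets [K] be enlarged freely, so two cylinders can be written over
    one common index set. *)
Definition cyls (J : set I) : set (set Om) :=
  [set F | exists (K : {fset I}) (B : I -> set R),
    [/\ forall i, measurable (B i), forall i, i \in K -> J i,
        forall i, i \notin K -> B i = setT & F = \bigcap_(i in [set` K]) X i @^-1` B i]].

Lemma cyl_widen (K K' : {fset I}) (B : I -> set R) : (K `<=` K')%fset ->
  (forall i, i \notin K -> B i = setT) ->
  \bigcap_(i in [set` K]) X i @^-1` B i = \bigcap_(i in [set` K']) X i @^-1` B i.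
Proof.
move=> KK' BT; apply/seteqP; split => [x xB i /= _|x xB i /= iK].
  by have [/xB//|/BT ->] := boolP (i \in K).
by apply: xB => /=; move/fsubsetP: KK'; exact.
Qed.

Lemma cyls_setI J : setI_closed (cyls J).
Proof.
move=> _ _ [K [B [mB KJ BT ->]]] [K' [B' [mB' KJ' BT' ->]]].
exists (K `|` K')%fset, (fun i => B i `&` B' i); split.
- by move=> i; exact: measurableI.
- by move=> i; rewrite inE => /orP[/KJ|/KJ'].
- by move=> i; rewrite inE negb_or => /andP[/BT -> /BT' ->]; rewrite setTI.
- rewrite (cyl_widen (fsubsetUl K K') BT) (cyl_widen (fsubsetUr K K') BT').
  by rewrite -bigcapI.
Qed.

Lemma cyls_setT J : cyls J setT.
Proof.
exists fset0, (fun=> setT); split => //.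
by apply/seteqP; split => // x _ i.
Qed.

Lemma cyls_measurable J : cyls J `<=` measurable.
Proof.
move=> _ [K [B [mB _ _ ->]]]; apply: fin_bigcap_measurable => // i _.
by rewrite -[X in measurable X]setTI; exact: measurable_funP.
Qed.

Lemma gens_cyls J : <<s gens J >> `<=` <<s cyls J >>.
Proof.
apply: sub_sigma_algebra2 => _ [i [B [Ji mB ->]]].
exists [fset i]%fset, (fun j => if j == i then B else setT); split.
- by move=> j; case: ifPn.
- by move=> j; rewrite inE => /eqP ->.
- by move=> j; rewrite inE => /negPf ->.
- by rewrite set_fset1 bigcap_set1 eqxx.
Qed.

Hypothesis indX : mutually_independent X.

Lemma cyls_indep J1 J2 C1 C2 : J1 `&` J2 = set0 -> cyls J1 C1 -> cyls J2 C2 ->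
  P (C1 `&` C2) = (P C1 * P C2)%E.
Proof.
move=> J12 [K [B [mB KJ BT ->]]] [K' [B' [mB' KJ' BT' ->]]].
rewrite (cyl_widen (fsubsetUl K K') BT) (cyl_widen (fsubsetUr K K') BT').
rewrite -bigcapI.
transitivity (P (\bigcap_(i in [set` (K `|` K')%fset]) X i @^-1` (B i `&` B' i))).
  by [].
rewrite !indX//; last by move=> i; exact: measurableI.
rewrite -big_split; apply: eq_bigr => i _ /=.
have [iK|/BT ->] := boolP (i \in K); last first.
  by rewrite setTI (_ : X i @^-1` setT = setT)// probability_setT mul1e.
have [iK'|/BT' ->] := boolP (i \in K'); last first.
  by rewrite setIT (_ : X i @^-1` setT = setT)// probability_setT mule1.
suff : (J1 `&` J2) i by rewrite J12.
by split; [exact: KJ|exact: KJ'].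
Qed.

(** [indep_g_sigma] is applied twice: with [E] fixed it reduces [F] to a cylinder, and with that
    cylinder fixed it reduces [E] to one. *)
Lemma gens_indep J1 J2 E F : J1 `&` J2 = set0 ->
  <<s gens J1 >> E -> <<s gens J2 >> F -> P (E `&` F) = (P E * P F)%E.
Proof.
move=> J12 /gens_cyls sE /gens_cyls sF.
have mE : measurable E.
  move: E sE; apply: smallest_sub; first exact: sigma_algebra_measurable.
  exact: cyls_measurable.
apply: (@indep_g_sigma (cyls J2)) => //.
- exact: cyls_measurable.
- exact: cyls_setI.
- exact: cyls_setT.
move=> C C2; rewrite setIC muleC; apply: (@indep_g_sigma (cyls J1)) => //.
- exact: cyls_measurable C2.
- exact: cyls_measurable.
- exact: cyls_setI.
- exact: cyls_setT.
by move=> C' C1; rewrite setIC muleC; exact: cyls_indep J12 C1 C2.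
Qed.

Lemma mutually_independent_comp (h h' : I -> I) : cancel h h' ->
  mutually_independent (fun i => X (h i)).
Proof.
move=> hK K B mB.
have := @indX [fset h i | i in K]%fset (fun i => B (h' i)) (fun i => mB _).
rewrite big_imfset/=; last by move=> i j _ _ /(can_inj hK).
under [X in _ = X]eq_bigr do rewrite hK.
move=> <-; congr (P _); apply/seteqP; split => [x xB i /imfsetP[j /= jK ->]|x xB i iK].
  by rewrite hK; exact: xB.
by have := xB (h i); rewrite /= hK; apply; apply/imfsetP; exists i.
Qed.

End independence.

(** * Expectations *)

Section bounded.
Context d (T : measurableType d) (R : realType).

Definition bmeas (f : T -> R) :=
  measurable_fun setT f /\ exists K, forall x, `|f x| <= K.

Lemma bmeas_cst c : bmeas (fun=> c).
Proof. by split => //; exists `|c|. Qed.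

Lemma bmeasD f g : bmeas f -> bmeas g -> bmeas (fun x => f x + g x).
Proof.
move=> [mf [K fK]] [mg [K' gK]]; split; first exact: measurable_funD.
by exists (K + K') => x; apply: (le_trans (ler_normD _ _)); exact: lerD.
Qed.

Lemma bmeasM f g : bmeas f -> bmeas g -> bmeas (fun x => f x * g x).
Proof.
move=> [mf [K fK]] [mg [K' gK]]; split; first exact: measurable_funM.
by exists (K * K') => x; rewrite normrM; exact: ler_pM.
Qed.

Lemma bmeasN f : bmeas f -> bmeas (fun x => - f x).
Proof.
move=> [mf [K fK]]; split; first exact: measurable_funN.
by exists K => x; rewrite normrN.
Qed.

Lemma bmeasB f g : bmeas f -> bmeas g -> bmeas (fun x => f x - g x).
Proof. by move=> bf bg; apply: bmeasD => //; exact: bmeasN. Qed.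

Lemma bmeas_max f g : bmeas f -> bmeas g -> bmeas (fun x => Num.max (f x) (g x)).
Proof.
move=> [mf [K fK]] [mg [K' gK]]; split; first exact: measurable_maxr.
exists (Num.max K K') => x; rewrite le_max.
by case: (leP (f x) (g x)) => _; rewrite ?fK ?gK ?orbT.
Qed.

Lemma bmeas_norm f : bmeas f -> bmeas (fun x => `|f x|).
Proof.
move=> [mf [K fK]]; split; first exact: measurableT_comp.
by exists K => x; rewrite normr_id.
Qed.

Lemma bmeas_sum (I : Type) (s : seq I) (f : I -> T -> R) :
  (forall i, bmeas (f i)) -> bmeas (fun x => \sum_(i <- s) f i x).
Proof.
move=> bf; elim: s => [|i s IH].
  by under [X in bmeas X]funext => x do rewrite big_nil; exact: bmeas_cst.
by under [X in bmeas X]funext => x do rewrite big_cons; exact: bmeasD.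
Qed.

Lemma bmeas_comp f (phi : T -> T) : measurable_fun setT phi ->
  bmeas f -> bmeas (fun x => f (phi x)).
Proof. by move=> mphi [mf [K fK]]; split; [exact: measurableT_comp|exists K]. Qed.

End bounded.

Section expectation.
Context d (T : measurableType d) (R : realType) (P : probability T R).

Definition int1 (f : T -> R) := P.-integrable setT (EFin \o f).

Definition Ex (f : T -> R) : R := \int[P]_x f x.

Lemma bmeas_int1 f : bmeas f -> int1 f.
Proof.
move=> [mf [K fK]]; apply: measurable_bounded_integrable => //.
  by rewrite -ge0_fin_numE// fin_num_measure.
exists K; split; first exact: num_real.
by move=> M KM x _; exact: le_trans (fK x) (ltW KM).
Qed.

Lemma int1D f g : int1 f -> int1 g -> int1 (fun x => f x + g x).
Proof. by move=> /(integrableD measurableT) h /h. Qed.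

Lemma int1Z c f : int1 f -> int1 (fun x => c * f x).
Proof. by move=> /(integrableZl measurableT c). Qed.

Lemma int1N f : int1 f -> int1 (fun x => - f x).
Proof. by move=> /integrableN; apply. Qed.

Lemma int1B f g : int1 f -> int1 g -> int1 (fun x => f x - g x).
Proof. by move=> ? ?; apply: int1D => //; exact: int1N. Qed.

Lemma int1_cst c : int1 (fun=> c).
Proof. by apply: bmeas_int1; exact: bmeas_cst. Qed.

Lemma int1_norm f : int1 f -> int1 (fun x => `|f x|).
Proof. exact: integrable_norm. Qed.

Lemma int1_sum (I : Type) (s : seq I) (f : I -> T -> R) :
  (forall i, int1 (f i)) -> int1 (fun x => \sum_(i <- s) f i x).
Proof.
move=> bf; elim: s => [|i s IH].
  by under [X in int1 X]funext => x do rewrite big_nil; exact: int1_cst.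
by under [X in int1 X]funext => x do rewrite big_cons; exact: int1D.
Qed.

Lemma ExD f g : int1 f -> int1 g -> Ex (fun x => f x + g x) = Ex f + Ex g.
Proof. exact: RintegralD. Qed.

Lemma ExZ c f : int1 f -> Ex (fun x => c * f x) = c * Ex f.
Proof. exact: RintegralZl. Qed.

Lemma Ex_cst c : Ex (fun=> c) = c.
Proof. by rewrite /Ex Rintegral_cst//= (@probability_setT _ _ _ P) mulr1. Qed.

Lemma ExN f : int1 f -> Ex (fun x => - f x) = - Ex f.
Proof.
move=> f1; rewrite -mulN1r -ExZ//; congr Ex; apply/funext => x.
by rewrite mulN1r.
Qed.

Lemma ExB f g : int1 f -> int1 g -> Ex (fun x => f x - g x) = Ex f - Ex g.
Proof. by move=> f1 g1; rewrite ExD ?ExN//; exact: int1N. Qed.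

Lemma Ex_sum (I : Type) (s : seq I) (f : I -> T -> R) :
  (forall i, int1 (f i)) ->
  Ex (fun x => \sum_(i <- s) f i x) = \sum_(i <- s) Ex (f i).
Proof.
move=> f1; elim: s => [|i s IH].
  by rewrite big_nil -[RHS]Ex_cst; congr Ex; apply/funext => x; rewrite big_nil.
rewrite big_cons -IH -ExD//; last exact: int1_sum.
by congr Ex; apply/funext => x; rewrite big_cons.
Qed.

Lemma le_Ex f g : int1 f -> int1 g -> (forall x, f x <= g x) -> Ex f <= Ex g.
Proof. by move=> f1 g1 fg; apply: le_Rintegral. Qed.

Lemma Ex_ge0 f : (forall x, 0 <= f x) -> 0 <= Ex f.
Proof. by move=> f0; apply: Rintegral_ge0. Qed.

Lemma Ex_comp f (phi : T -> T) : measurable_fun setT phi ->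
  (forall A, measurable A -> P (phi @^-1` A) = P A) -> int1 f ->
  int1 (fun x => f (phi x)) /\ Ex (fun x => f (phi x)) = Ex f.
Proof.
move=> mphi phiP f1; have mf := measurable_int _ f1.
have f1' : int1 (fun x => f (phi x)).
  apply/integrableP; split; first exact: measurableT_comp mf mphi.
  case/integrableP: (f1) => _; congr (_ < _)%E.
  transitivity (\int[pushforward P phi]_x `|(EFin \o f) x|)%E.
    apply: eq_measure_integral => A mA _.
    exact/esym/phiP.
  rewrite ge0_integral_pushforward//.
  exact: measurableT_comp.
split => //; rewrite /Ex/Rintegral; congr fine.
transitivity (\int[pushforward P phi]_x (EFin \o f) x)%E.
  by rewrite integral_pushforward.
by apply: eq_measure_integral => A mA _; exact: phiP.
Qed.

(* Cauchy-Schwarz against the constant 1. *)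
Lemma Ex_norm_sqr f : bmeas f -> Ex (fun x => `|f x|) ^+ 2 <= Ex (fun x => f x ^+ 2).
Proof.
move=> bf; set m := Ex (fun x => `|f x|).
have bn := bmeas_norm bf; have := bmeasM bf bf => bff.
have : 0 <= Ex (fun x => (`|f x| - m) ^+ 2) by apply: Ex_ge0 => x; exact: sqr_ge0.
rewrite (_ : (fun x => _) = fun x => f x ^+ 2 - (2 * m) * `|f x| + m ^+ 2); last first.
  by apply/funext => x; rewrite -(real_normK (num_real (f x))); ring.
rewrite ExD ?ExB ?Ex_cst ?ExZ//.
- rewrite -/m => h; rewrite -subr_ge0; move: h.
  by congr (0 <= _); ring.
- exact: bmeas_int1.
- exact: bmeas_int1 bff.
- by apply: int1Z; exact: bmeas_int1.
- apply: int1B; first exact: bmeas_int1 bff.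
  by apply: int1Z; exact: bmeas_int1.
- exact: int1_cst.
Qed.

Lemma Ex_dominated_cvg (f_ : nat -> T -> R) (f g : T -> R) :
  (forall n, measurable_fun setT (f_ n)) -> measurable_fun setT f ->
  int1 g -> (forall n x, `|f_ n x| <= g x) ->
  {ae P, forall x, f_ n x @[n --> \oo] --> f x} ->
  Ex (f_ n) @[n --> \oo] --> Ex f.
Proof.
move=> mf_ mf g1 f_g f_f.
have [|||||f1 _ cvE] := @dominated_convergence _ T R P setT measurableT
  (fun n => EFin \o f_ n) (EFin \o f) (EFin \o g).
- by move=> n; exact/measurable_EFinP.
- exact/measurable_EFinP.
- apply: filterS f_f => x f_fx _; apply: cvg_EFin => //; exact: nearW.
- exact: g1.
- by apply: nearW => x n _ /=; rewrite lee_fin.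
rewrite /Ex /Rintegral; apply: fine_cvg; rewrite fineK//.
exact: integrable_fin_num.
Qed.

End expectation.

(** * A mean ergodic theorem for averages over a random walk *)

Section ergodic.
Context d (T : measurableType d) (R : realType) (P : probability T R).
Variable tau : int -> T -> T.
Hypothesis mtau : forall k, measurable_fun setT (tau k).
Hypothesis tauP : forall k A, measurable A -> P (tau k @^-1` A) = P A.
Hypothesis tauD : forall k l x, tau (k + l) x = tau k (tau l x).
Hypothesis tau0 : forall x, tau 0 x = x.
Hypothesis erg : forall B, measurable B -> (forall k, tau k @^-1` B = B) ->
  P B = 0%E \/ P B = 1%E.

Local Notation Ex := (Ex P).
Local Notation int1 := (int1 P).

Lemma int1_tau k f : int1 f -> int1 (fun x => f (tau k x)).
Proof. by case/(Ex_comp (mtau k) (tauP k)). Qed.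

Lemma Ex_tau k f : int1 f -> Ex (fun x => f (tau k x)) = Ex f.
Proof. by case/(Ex_comp (mtau k) (tauP k)). Qed.

Fixpoint birk (f : T -> R) (n : nat) (x : T) : R :=
  if n is m.+1 then f x + birk f m (tau 1 x) else 0.

(** The maximum of [birk f k x] over [k <= n], in the recursive form that drives the maximal ergodic
    argument. *)
Fixpoint maxbirk (f : T -> R) (n : nat) (x : T) : R :=
  if n is m.+1 then Num.max 0 (f x + maxbirk f m (tau 1 x)) else 0.

Lemma birkE f n x : birk f n x = \sum_(0 <= j < n) f (tau j%:Z x).
Proof.
elim: n x => [|n IH] x /=; first by rewrite big_geq.
rewrite big_nat_recl//= tau0 IH; congr (_ + _).
by apply: eq_bigr => j _; rewrite -tauD -PoszD addn1.
Qed.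

Lemma bmeas_birk f n : bmeas f -> bmeas (birk f n).
Proof.
move=> bf; elim: n => [|n IH] /=; first exact: bmeas_cst.
apply: bmeasD => //; exact: (bmeas_comp (mtau 1) IH).
Qed.

Lemma bmeas_maxbirk f n : bmeas f -> bmeas (maxbirk f n).
Proof.
move=> bf; elim: n => [|n IH] /=; first exact: bmeas_cst.
apply: bmeas_max; first exact: bmeas_cst.
apply: bmeasD => //; exact: (bmeas_comp (mtau 1) IH).
Qed.

Lemma maxbirk_ge0 f n x : 0 <= maxbirk f n x.
Proof. by case: n => //= n; rewrite le_max lexx. Qed.

Lemma maxbirk_nd f n x : maxbirk f n x <= maxbirk f n.+1 x.
Proof.
elim: n x => [|n IH] x; first by rewrite /= le_max lexx.
by rewrite [leLHS]/= [leRHS]/= ge_max !le_max lexx/= lerD2l IH orbT.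
Qed.

Lemma birk_maxbirk f k n x : (k <= n)%N -> birk f k x <= maxbirk f n x.
Proof.
elim: n k x => [|n IH] [|k] x //= kn; first by rewrite le_max lexx.
by rewrite le_max lerD2l IH// orbT.
Qed.

(** This set is invariant under every [tau k] at each point and not only almost surely, as the
    hypothesis [erg] demands. *)
Definition unbounded_birk f : set T :=
  [set x | forall K : nat, exists n, K%:R < birk f n x].

Lemma measurable_unbounded_birk f : bmeas f -> measurable (unbounded_birk f).
Proof.
move=> bf; rewrite (_ : unbounded_birk f =
  \bigcap_K \bigcup_n birk f n @^-1` `]K%:R, +oo[).
  apply: bigcapT_measurable => K; apply: bigcupT_measurable => n.
  by rewrite -[X in measurable X]setTI; exact: (bmeas_birk n bf).1.
apply/seteqP; split => x xf K => [_|].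
  by have [n nK] := xf K; exists n => //=; rewrite in_itv/= nK.
by have [n _ /=] := xf K I; rewrite in_itv/= andbT; exists n.
Qed.

(** The sums at [x] and at [tau 1 x] differ by the term [f x] and one step in length, so raising the
    level by [|f x|] absorbs the change. *)
Lemma unbounded_birk_tau1 f x : unbounded_birk f (tau 1 x) <-> unbounded_birk f x.
Proof.
have bigK K : exists K' : nat, K%:R + `|f x| < K'%:R.
  by exists (Num.truncn (K%:R + `|f x|)).+1; exact: truncnS_gt.
split=> ub K; have [K' KK'] := bigK K; have [n nK] := ub K'.
  exists n.+1 => /=; have := ler_norm (- f x); rewrite normrN; lra.
case: n nK => [|n] /= nK.
  have : (0 : R) <= K%:R by []; have := normr_ge0 (f x); lra.
by exists n; have := ler_norm (f x); lra.
Qed.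

Lemma unbounded_birk_tau f k : tau k @^-1` unbounded_birk f = unbounded_birk f.
Proof.
have nat_tau (n : nat) x : unbounded_birk f (tau n x) <-> unbounded_birk f x.
  elim: n x => [|n IH] x; first by rewrite tau0.
  by rewrite -[n.+1]addn1 PoszD tauD IH; exact: unbounded_birk_tau1.
apply/seteqP; split=> x /=; case: k => n; rewrite ?nat_tau//.
  by move/nat_tau: (n.+1) => <-; rewrite -tauD NegzE subrr tau0.
by move=> ux; apply/(nat_tau n.+1); rewrite -tauD NegzE subrr tau0.
Qed.

(* On the invariant set where the Birkhoff sums are unbounded above,
   [maxbirk f n.+1 - maxbirk f n \o tau 1] decreases to [f], while its
   expectation is nonnegative. *)
Lemma unbounded_birk0 f : bmeas f -> Ex f < 0 -> P (unbounded_birk f) = 0%E.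
Proof.
move=> bf f0.
have [//|PB] := erg (measurable_unbounded_birk bf) (unbounded_birk_tau f).
pose h n x := maxbirk f n.+1 x - maxbirk f n (tau 1 x).
have bM n : bmeas (maxbirk f n) := bmeas_maxbirk n bf.
have bMt n : bmeas (fun x => maxbirk f n (tau 1 x)) := bmeas_comp (mtau 1) (bM n).
have bh n : bmeas (h n) by exact: bmeasB.
have Eh n : 0 <= Ex (h n).
  rewrite ExB; [|exact: bmeas_int1 (bM n.+1)|exact: bmeas_int1 (bMt n)].
  rewrite (Ex_tau 1 (bmeas_int1 P (bM n))) subr_ge0.
  apply: le_Ex => [||x]; [exact: bmeas_int1|exact: bmeas_int1|exact: maxbirk_nd].
(* With [m] the value of [maxbirk f n] at [tau 1 x], [h n x] is [max (- m) (f x)], and [m >= 0]. *)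
have hf n x : `|h n x| <= `|f x|.
  rewrite /h/=; have := maxbirk_ge0 f n (tau 1 x).
  by rewrite ler_norml; case: (leP 0 (_ + _)); case: (ger0P (f x)) => ? ? ?;
    apply/andP; split; lra.
have : Ex (h n) @[n --> \oo] --> Ex f.
  have [mf [K fK]] := bf.
  apply: (@Ex_dominated_cvg _ _ _ _ h f (fun=> K)) => //.
  - by move=> n; exact: (bh n).1.
  - exact: int1_cst.
  - by move=> n x; exact: le_trans (hf n x) (fK x).
  exists (~` unbounded_birk f); split.
  - exact/measurableC/measurable_unbounded_birk.
  - by rewrite probability_setC ?PB ?subee//; exact: measurable_unbounded_birk.
  move=> x /= nx ux; apply: nx; move/unbounded_birk_tau1 : ux => ux.
  apply: cvg_near_cst.
  (* Once the running maximum at [tau 1 x] reaches [- f x], the outer maximum with 0 is attained by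
     the other argument, and [h n x] equals [f x] exactly. *)
  have [K' KK'] : exists K' : nat, - f x < K'%:R.
    by exists (Num.truncn (- f x)).+1; exact: truncnS_gt.
  have [m mK] := ux K'.
  exists m => // n /= mn; rewrite /h/=.
  have := birk_maxbirk f (tau 1 x) mn.
  by move=> ?; apply/eqP; case: (leP 0) => ?; lra.
move=> cvh; have : 0 <= Ex f.
  by rewrite -(cvg_lim _ cvh)//; apply: limr_ge; [exact: cvgP cvh|exact: nearW].
by rewrite leNgt f0.
Qed.

(** A bounded function of negative mean has Birkhoff sums bounded above almost surely. For
    [g - e / 4] this makes the positive part of the averages vanish in mean, and since [birk g n]
    has mean zero its positive part controls its absolute value. *)
Lemma birk_L1 g e : bmeas g -> Ex g = 0 -> 0 < e ->
  exists2 n, (0 < n)%N & Ex (fun x => `|birk g n x|) <= e * n%:R.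
Proof.
move=> bg g0 e0.
pose f x := g x - e / 4.
have bf : bmeas f by apply: bmeasB => //; exact: bmeas_cst.
have Ef : Ex f < 0.
  rewrite ExB ?Ex_cst ?g0; [lra|exact: bmeas_int1|exact: int1_cst].
have Pf := unbounded_birk0 bf Ef.
have birkf n x : birk g n x = birk f n x + n%:R * (e / 4).
  elim: n x => [|n IH] x /=; first by rewrite mul0r addr0.
  by rewrite IH /f -natr1; lra.
have Eb n : Ex (birk g n) = 0.
  elim: n => [|n IH] /=; first exact: Ex_cst.
  rewrite ExD; first last.
  - by apply: int1_tau; apply: bmeas_int1; exact: bmeas_birk.
  - exact: bmeas_int1.
  by rewrite (Ex_tau 1)// ?IH ?g0 ?addr0//; apply: bmeas_int1; exact: bmeas_birk.
have [mf [K fK]] := bf.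
have birkK n x : `|birk f n x| <= n%:R * K.
  elim: n x => [|n IH] x /=; first by rewrite normr0 mul0r.
  apply: (le_trans (ler_normD _ _)); have := fK x; have := IH (tau 1 x).
  by rewrite -natr1; lra.
have K0 : 0 <= K by exact: le_trans (normr_ge0 _) (fK point).
pose h n x := n.+1%:R^-1 * Num.max 0 (birk f n.+1 x).
have bh n : bmeas (h n).
  apply: bmeasM; first exact: bmeas_cst.
  by apply: bmeas_max; [exact: bmeas_cst|exact: bmeas_birk].
have : Ex (h n) @[n --> \oo] --> Ex (fun=> 0).
  apply: (@Ex_dominated_cvg _ _ _ _ h _ (fun=> K)) => //.
  - by move=> n; exact: (bh n).1.
  - exact: int1_cst.
  - move=> n x; rewrite /h normrM ger0_norm// mulrC ler_pdivrMr//.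
    have := birkK n.+1 x; rewrite mulrC; case: (leP 0) => // _ _.
    by rewrite normr0 mulr_ge0.
  exists (unbounded_birk f); split => //; first exact: measurable_unbounded_birk.
  move=> x /= nx; apply: contrapT => /existsNP[k kx]; apply: nx.
  have {}kx n : birk f n x <= k%:R.
    by rewrite leNgt; apply/negP => h'; apply: kx; exists n.
  apply: (@squeeze_cvgr _ _ _ _ (fun=> 0) (fun n => n.+1%:R^-1 * k%:R)).
  - apply: nearW => n; apply/andP; split.
      by rewrite mulr_ge0// le_max lexx.
    by apply: ler_wpM2l => //; rewrite ge_max kx ler0n.
  - exact: cvg_cst.
  - rewrite -[X in _ --> X](mul0r k%:R); apply: cvgM; last exact: cvg_cst.
    exact: cvg_harmonic.
rewrite Ex_cst => /cvgrPdist_lt/(_ (e / 4))[|n _ /(_ n (leqnn n))/=]; first lra.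
rewrite sub0r normrN ger0_norm; last first.
  by apply: Ex_ge0 => x; rewrite mulr_ge0// le_max lexx.
move=> hn; exists n.+1 => //.
(* This is [|y| = 2 y^+ - y] for [y = birk g n.+1 x], with [y^+] at most [n.+1 * (h n x + e / 4)].
   The mean of [h n] is below [e / 4], so the two quarters, doubled, give [e]. *)
have : Ex (fun x => `|birk g n.+1 x|) <=
    Ex (fun x => 2 * n.+1%:R * (h n x + e / 4) - birk g n.+1 x).
  apply: le_Ex.
  - apply: int1_norm; apply: bmeas_int1; exact: bmeas_birk.
  - apply: int1B; last by apply: bmeas_int1; exact: bmeas_birk.
    apply: int1Z; apply: int1D; [exact: bmeas_int1|exact: int1_cst].
  move=> x; rewrite birkf /h mulrDr -[2 * _ * (_ * _)]mulrA mulVKf//.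
  rewrite ler_norml; case: (leP 0 (birk f n.+1 x));
    have : 0 <= n.+1%:R * (e / 4) by rewrite mulr_ge0//; lra.
    by move=> ? ?; apply/andP; split; lra.
  by move=> ? ?; apply/andP; split; lra.
rewrite ExB; first last.
- by apply: bmeas_int1; exact: bmeas_birk.
- by apply: int1Z; apply: int1D; [exact: bmeas_int1|exact: int1_cst].
rewrite Eb subr0 ExZ; last by apply: int1D; [exact: bmeas_int1|exact: int1_cst].
rewrite ExD; [|exact: bmeas_int1|exact: int1_cst]; rewrite Ex_cst.
move=> h'; apply: le_trans h' _.
have n0 : 0 <= n.+1%:R :> R by [].
by have := ler_wpM2l n0 (ltW hn); lra.
Qed.

End ergodic.

(** [D] is a subgroup of the integers. Its least positive element [k] divides all differences of
    support points, so the support lies in one class modulo [k], and the span condition gives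
    [k = 1]. *)
Lemma W2_subgroup (R : realType) (w : int -> R) (D : set int) : W2 w ->
  D 0 -> (forall k l, D k -> D l -> D (k - l)) ->
  (forall a b, supp w a -> supp w b -> D (a - b)) -> D 1.
Proof.
move=> [_ span1] D0 DB Dsupp.
have DN k : D k -> D (- k) by move=> Dk; rewrite -sub0r; exact: DB.
have DD k l : D k -> D l -> D (k + l).
  by move=> Dk Dl; rewrite -[l]opprK; apply: DB => //; exact: DN.
have DMn k (n : nat) : D k -> D (k * n%:Z).
  move=> Dk; elim: n => [|n IH]; first by rewrite mulr0.
  by rewrite -addn1 PoszD mulrDr mulr1; exact: DD.
have DM k m : D k -> D (k * m).
  by case: m => n Dk; [exact: DMn|rewrite NegzE mulrN; apply/DN/DMn].
have span_in n : (forall a b, supp w a -> supp w b -> exists m, b - a = n%:Z * m) ->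
    span_set w n.
  move=> sn; have [[a sa]|/forallNP s0] := pselect (exists a, supp w a).
    exists a => b sb; have [m bam] := sn _ _ sa sb.
    by exists m => //; rewrite -bam addrC subrK.
  by exists 0 => b /s0.
pose Q (n : nat) := `[< (0 < n)%N /\ D n >].
(* If [D] were trivial, the support would have at most one point and would lie in a class modulo 2,
   against the span bound. *)
have exQ : exists n, Q n.
  apply: contrapT => /forallNP Dn.
  have {}Dn k : D k -> k = 0.
    move=> Dk; apply/eqP; rewrite -absz_eq0 -leqn0 leqNgt; apply/negP => k0.
    apply: (Dn `|k|%N); apply/asboolP; split=> //.
    by case: k Dk {k0} => // m; rewrite NegzE => /DN; rewrite opprK abszN.
  have /span1 : span_set w 2.
    by apply: span_in => a b sa sb; exists 0; rewrite mulr0; exact/Dn/Dsupp.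
  by [].
case: (ex_minnP exQ) => k /asboolP[k0 Dk] kmin.
have Dk_dvd x : D x -> exists m, x = k%:Z * m.
  move=> Dx; exists (x %/ k)%Z.
  suff xk0 : (x %% k)%Z = 0 by rewrite [LHS](divz_eq x k) xk0 addr0 mulrC.
  have kN0 : k%:Z != 0 by rewrite -lt0n.
  have := modz_ge0 x kN0; have := ltz_mod x kN0.
  have : D (x %% k)%Z by rewrite /modz mulrC; apply: DB => //; exact: DM.
  case: (x %% k)%Z => // r Dr rk _; apply/eqP; rewrite eqz_nat -leqn0 leqNgt.
  apply/negP => r0; have := kmin r; rewrite leqNgt => /(_ _)/negP; apply.
    by apply/asboolP.
  by move: rk; rewrite /= gtr0_norm.
have : span_set w k by apply: span_in => a b sa sb; exact/Dk_dvd/Dsupp.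
move/span1; rewrite leEnat => k1.
by have keq1 : k = 1%N; [apply/eqP; rewrite eqn_leq k0 k1|rewrite keq1 in Dk].
Qed.

(** * Iterated averages over the shifts *)

Section averaging.
Context d (T : measurableType d) (R : realType) (P : probability T R).
Variable tau : int -> T -> T.
Hypothesis mtau : forall k, measurable_fun setT (tau k).
Hypothesis tauP : forall k A, measurable A -> P (tau k @^-1` A) = P A.
Hypothesis tauD : forall k l x, tau (k + l) x = tau k (tau l x).
Hypothesis tau0 : forall x, tau 0 x = x.
Hypothesis erg : forall B, measurable B -> (forall k, tau k @^-1` B = B) ->
  P B = 0%E \/ P B = 1%E.
Variables (L : seq int) (w : int -> R).
Hypothesis w0 : forall k, 0 <= w k.
Hypothesis w1 : \sum_(k <- L) w k = 1.

Local Notation Ex := (Ex P).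
Local Notation int1 := (int1 P).

Definition av (g : T -> R) (x : T) : R := \sum_(k <- L) w k * g (tau k x).

Lemma bmeas_av g : bmeas g -> bmeas (av g).
Proof.
move=> bg; apply: bmeas_sum => k; apply: bmeasM; first exact: bmeas_cst.
exact: bmeas_comp.
Qed.

Lemma bmeas_iter_av t g : bmeas g -> bmeas (iter t av g).
Proof. by move=> bg; elim: t => //= t; exact: bmeas_av. Qed.

Lemma int1_av g : int1 g -> int1 (av g).
Proof.
by move=> g1; apply: int1_sum => k; exact: (int1Z (w k) (int1_tau mtau tauP k g1)).
Qed.

Lemma int1_iter_av t g : int1 g -> int1 (iter t av g).
Proof. by move=> bg; elim: t => //= t; exact: int1_av. Qed.

Lemma av_tau g k : av (fun x => g (tau k x)) = fun x => av g (tau k x).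
Proof.
by apply/funext => x; apply: eq_bigr => l _; rewrite -!tauD addrC.
Qed.

Lemma iter_av_tau t g k :
  iter t av (fun x => g (tau k x)) = fun x => iter t av g (tau k x).
Proof. by elim: t => //= t ->; exact: av_tau. Qed.

Lemma avD f g : av (fun x => f x + g x) = fun x => av f x + av g x.
Proof.
apply/funext => x; rewrite /av -big_split; apply: eq_bigr => k _ /=.
by rewrite mulrDr.
Qed.

Lemma iter_avD t f g :
  iter t av (fun x => f x + g x) = fun x => iter t av f x + iter t av g x.
Proof. by elim: t => //= t ->; exact: avD. Qed.

Lemma av_cst c : av (fun=> c) = fun=> c.
Proof. by apply/funext => x; rewrite /av -mulr_suml w1 mul1r. Qed.

Lemma iter_av_cst t c : iter t av (fun=> c) = fun=> c.
Proof. by elim: t => //= t ->; exact: av_cst. Qed.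

(** Averages commute with the action, so the Birkhoff sum of an iterate inherits the smallness of
    [birk tau g n] through the contraction [Ex_norm_av]. *)
Lemma iter_av_birk t g n : iter t av (birk tau g n) = birk tau (iter t av g) n.
Proof.
elim: n => [|n IH] /=; first exact: iter_av_cst.
by rewrite iter_avD iter_av_tau IH.
Qed.

(** Each averaging is a contraction of L^1: the triangle inequality inside the weighted sum, then
    invariance of [P] under each [tau k]. *)
Lemma Ex_norm_av t g : int1 g ->
  Ex (fun x => `|iter t av g x|) <= Ex (fun x => `|g x|).
Proof.
move=> g1; elim: t => //= t; apply: le_trans.
have h1 : int1 (fun x => `|iter t av g x|) by apply: int1_norm; exact: int1_iter_av.
have : Ex (fun x => `|av (iter t av g) x|) <=
    Ex (fun x => \sum_(k <- L) w k * `|iter t av g (tau k x)|).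
  apply: le_Ex.
  - by apply: int1_norm; apply: int1_av; exact: int1_iter_av.
  - by apply: int1_sum => k; apply: int1Z; exact: (int1_tau mtau tauP k h1).
  move=> x; apply: le_trans (ler_norm_sum _ _ _) _.
  by apply: ler_sum => k _; rewrite normrM ger0_norm.
move=> h; apply: le_trans h _; rewrite Ex_sum; last first.
  by move=> k; apply: int1Z; exact: (int1_tau mtau tauP k h1).
rewrite (eq_bigr (fun k => w k * Ex (fun x => `|iter t av g x|))).
  by rewrite -mulr_suml w1 mul1r.
move=> k _; rewrite ExZ; last exact: (int1_tau mtau tauP k h1).
by rewrite (Ex_tau mtau tauP k h1).
Qed.

(** The right-hand side is the variance of [y] under the weights [w], a sum of nonnegative terms of
    which one at [a] is kept. *)
Lemma variance_term (y : int -> R) a : a \in L ->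
  w a * (y a - \sum_(k <- L) w k * y k) ^+ 2 <=
  \sum_(k <- L) w k * y k ^+ 2 - (\sum_(k <- L) w k * y k) ^+ 2.
Proof.
move=> aL; set m := \sum_(k <- L) w k * y k.
have -> : \sum_(k <- L) w k * y k ^+ 2 - m ^+ 2 =
    \sum_(k <- L) w k * (y k - m) ^+ 2.
  rewrite [RHS](eq_bigr (fun k => w k * y k ^+ 2 - (2 * m) * (w k * y k) +
    m ^+ 2 * w k)); last by move=> k _; ring.
  by rewrite big_split/= sumrB -!mulr_sumr w1 -/m; ring.
rewrite (perm_big _ (perm_to_rem aL)) big_cons lerDl.
by apply: sumr_ge0 => k _; rewrite mulr_ge0// sqr_ge0.
Qed.

(* The energy [Ex (iter t av g ^+ 2)] decreases, so this loss tends to 0 along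
   the iterates: the source of [L2null_step]. *)
Lemma energy g a : bmeas g -> a \in L ->
  w a * Ex (fun x => (g (tau a x) - av g x) ^+ 2) <=
  Ex (fun x => g x ^+ 2) - Ex (fun x => av g x ^+ 2).
Proof.
move=> bg aL.
have bgt k : bmeas (fun x => g (tau k x)) by exact: bmeas_comp.
have bsq (f : T -> R) : bmeas f -> bmeas (fun x : T => f x ^+ 2).
  by move=> bf; exact: (bmeasM bf bf).
have bd : bmeas (fun x => (g (tau a x) - av g x) ^+ 2).
  by apply: bsq; apply: bmeasB => //; exact: bmeas_av.
have bs : bmeas (fun x => \sum_(k <- L) w k * g (tau k x) ^+ 2).
  by apply: bmeas_sum => k; apply: bmeasM; [exact: bmeas_cst|exact: bsq].
rewrite -ExZ; last exact: bmeas_int1.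
(* Invariance of [P] spreads the second moment of [g] over the shifts in [L], so that
   [variance_term] applies pointwise. *)
have -> : Ex (fun x => g x ^+ 2) = Ex (fun x => \sum_(k <- L) w k * g (tau k x) ^+ 2).
  have g2 : int1 (fun x => g x ^+ 2) by apply: bmeas_int1; exact: bsq.
  rewrite Ex_sum => [|k]; last by apply: int1Z; exact: (int1_tau mtau tauP k g2).
  under eq_bigr => k _.
    rewrite ExZ; last exact: (int1_tau mtau tauP k g2).
    by rewrite (Ex_tau mtau tauP k g2); over.
  by rewrite -mulr_suml w1 mul1r.
have ba := bsq (av g) (bmeas_av bg).
rewrite -ExB; [|exact: bmeas_int1|exact: bmeas_int1].
apply: le_Ex => [||x]; last exact: (variance_term (fun k => g (tau k x)) aL).
- by apply: bmeas_int1; apply: bmeasM => //; exact: bmeas_cst.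
- by apply: bmeas_int1; exact: bmeasB.
Qed.

Definition L2null (u : nat -> T -> R) :=
  (forall t, bmeas (u t)) /\ (Ex (fun x => u t x ^+ 2) @[t --> \oo] --> (0 : R)).

Lemma L2nullD u v : L2null u -> L2null v -> L2null (fun t x => u t x + v t x).
Proof.
move=> [bu u0] [bv v0].
have buv t : bmeas (fun x => u t x + v t x) by exact: bmeasD.
split => //.
apply: (@squeeze_cvgr _ _ _ _ (fun=> 0)
  (fun t => 2 * Ex (fun x => u t x ^+ 2) + 2 * Ex (fun x => v t x ^+ 2))).
- apply: nearW => t; apply/andP; split; first by apply: Ex_ge0 => x; exact: sqr_ge0.
  have iu : int1 (fun x => u t x ^+ 2) by apply: bmeas_int1; exact: (bmeasM (bu t) (bu t)).
  have iv : int1 (fun x => v t x ^+ 2) by apply: bmeas_int1; exact: (bmeasM (bv t) (bv t)).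
  rewrite -!ExZ// -ExD; [|exact: int1Z|exact: int1Z].
  apply: le_Ex => [||x].
  + by apply: bmeas_int1; exact: (bmeasM (buv t) (buv t)).
  + by apply: int1D; exact: int1Z.
  by have := sqr_ge0 (u t x - v t x); lra.
- exact: cvg_cst.
- rewrite -[X in _ --> X]addr0 -[X in _ --> X + _](mulr0 2) -[X in _ --> _ + X](mulr0 2).
  by apply: cvgD; apply: cvgM => //; exact: cvg_cst.
Qed.

Lemma L2nullN u : L2null u -> L2null (fun t x => - u t x).
Proof.
move=> [bu u0]; split; first by move=> t; exact: bmeasN.
rewrite (_ : (fun t => _) = fun t => Ex (fun x => u t x ^+ 2))//.
by apply/funext => t; congr Ex; apply/funext => x; rewrite sqrrN.
Qed.

Lemma L2null_tau u k : L2null u -> L2null (fun t x => u t (tau k x)).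
Proof.
move=> [bu u0]; split; first by move=> t; exact: bmeas_comp.
have := u0; rewrite [X in X @ _ --> _ -> _](_ : _ =
  fun t => Ex (fun x => u t (tau k x) ^+ 2))//.
apply/funext => t; rewrite (@Ex_tau _ _ _ _ _ mtau tauP k (fun x => u t x ^+ 2))//.
by apply: bmeas_int1; exact: (bmeasM (bu t) (bu t)).
Qed.

Lemma L2null_L1 u : L2null u -> Ex (fun x => `|u t x|) @[t --> \oo] --> (0 : R).
Proof.
move=> [bu u0]; apply/cvgrPdist_lt => e e0.
have e20 : 0 < e ^+ 2 by rewrite exprn_gt0.
move/cvgrPdist_lt : u0 => /(_ _ e20); apply: filterS => t.
rewrite !sub0r !normrN !ger0_norm; first last.
- by apply: Ex_ge0 => x; exact: sqr_ge0.
- by apply: Ex_ge0 => x.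
move=> h; rewrite -(@ltr_pXn2r _ 2)// ?nnegrE; [|by apply: Ex_ge0|exact: ltW].
exact: le_lt_trans (Ex_norm_sqr P (bu t)) h.
Qed.

(** The second moments of the iterates are nonincreasing and nonnegative, hence convergent, so their
    successive differences tend to 0. *)
Lemma L2null_step g a : bmeas g -> a \in L -> 0 < w a ->
  L2null (fun t x => iter t av g (tau a x) - iter t.+1 av g x).
Proof.
move=> bg aL wa.
have bgt t := bmeas_iter_av t bg.
have bu t : bmeas (fun x => iter t av g (tau a x) - iter t.+1 av g x).
  by apply: bmeasB; [exact: bmeas_comp|exact: (bgt t.+1)].
split => //.
pose e t := Ex (fun x => iter t av g x ^+ 2).
have e0 t : 0 <= e t by apply: Ex_ge0 => x; exact: sqr_ge0.
have ee t :
    w a * Ex (fun x => (iter t av g (tau a x) - iter t.+1 av g x) ^+ 2) <= e t - e t.+1.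
  exact: energy.
have end_ t : e t.+1 <= e t.
  rewrite -subr_ge0; apply: le_trans (ee t); apply: mulr_ge0 => //.
  by apply: Ex_ge0 => x; exact: sqr_ge0.
have cve : cvgn e.
  apply: nonincreasing_is_cvgn; first exact/nonincreasing_seqP.
  by exists 0 => _ [t _ <-].
apply: (@squeeze_cvgr _ _ _ _ (fun=> 0) (fun t => (w a)^-1 * (e t - e t.+1))).
- apply: nearW => t; apply/andP; split; first by apply: Ex_ge0 => x; exact: sqr_ge0.
  by rewrite ler_pdivlMl.
- exact: cvg_cst.
- rewrite (_ : 0 = (w a)^-1 * (limn e - limn e)); last by rewrite subrr mulr0.
  apply: cvgM; first exact: cvg_cst.
  by apply: cvgB => //; rewrite (cvg_shiftS e).
Qed.

(** The subgroup to which [W2_subgroup] is applied: the shifts that the iterated averages of [g]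
    cease to notice in L^2. *)
Definition asym_inv g : set int :=
  [set k | L2null (fun t x => iter t av g (tau k x) - iter t av g x)].

(** Shifting by [a] and by [b] both lead, asymptotically, to the same iterate [iter t.+1 av g].
    Subtract, then translate by [- b]. *)
Lemma asym_inv_diff g a b : bmeas g -> a \in L -> b \in L -> 0 < w a -> 0 < w b ->
  asym_inv g (a - b).
Proof.
move=> bg aL bL wa wb.
have /(L2null_tau (- b)) := L2nullD (L2null_step bg aL wa) (L2nullN (L2null_step bg bL wb)).
congr L2null; apply/funext => t; apply/funext => x.
by rewrite -!tauD subrr tau0; ring.
Qed.

Lemma asym_inv0 g : bmeas g -> asym_inv g 0.
Proof.
move=> bg; rewrite /asym_inv/=.
rewrite (_ : (fun _ _ => _) = fun _ _ => 0); last first.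
  by apply/funext => t; apply/funext => x; rewrite tau0 subrr.
split; first by move=> t; exact: bmeas_cst.
rewrite (_ : (fun t => _) = fun=> 0); first exact: cvg_cst.
by apply/funext => t; rewrite expr0n/= Ex_cst.
Qed.

Lemma asym_invB g k l : asym_inv g k -> asym_inv g l -> asym_inv g (k - l).
Proof.
move=> gk gl; have := L2nullD gk (L2nullN gl) => /(L2null_tau (- l)).
congr L2null; apply/funext => t; apply/funext => x.
by rewrite -!tauD subrr tau0; ring.
Qed.

Hypothesis suppL : forall k, supp w k -> k \in L.
Hypothesis span1 : W2 w.

Lemma asym_invT g (j : nat) : bmeas g -> asym_inv g j.
Proof.
move=> bg; have g1 : asym_inv g 1.
  apply: (W2_subgroup span1 (asym_inv0 bg)) => [k l|a b sa sb]; first exact: asym_invB.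
  by apply: asym_inv_diff => //; exact: suppL.
elim: j => [|j IH]; first exact: asym_inv0.
have gN1 : asym_inv g (- 1) by rewrite -sub0r; apply: asym_invB => //; exact: asym_inv0.
by rewrite -addn1 PoszD -[1%:Z]opprK; exact: asym_invB.
Qed.

Lemma L2null_birk g n : bmeas g ->
  L2null (fun t x => birk tau (iter t av g) n x - n%:R * iter t av g x).
Proof.
move=> bg.
rewrite (_ : (fun _ _ => _) = fun t x =>
  \sum_(0 <= j < n) (iter t av g (tau j x) - iter t av g x)); last first.
  apply/funext => t; apply/funext => x.
  by rewrite (birkE tauD tau0) sumrB sumr_const_nat subn0 mulr_natl.
elim: n => [|n IH].
  have := asym_inv0 bg; congr L2null; apply/funext => t; apply/funext => x.
  by rewrite big_geq// tau0 subrr.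
have := L2nullD IH (asym_invT n bg); congr L2null; apply/funext => t; apply/funext => x.
by rewrite big_nat_recr.
Qed.

(** The length [n] is fixed first, by [birk_L1]. Then [n] times the iterate is within an L^2-null
    error of its Birkhoff sum, whose mean absolute value is at most [e / 2 * n] for every [t]. *)
Lemma av_L1_bmeas g : bmeas g -> Ex g = 0 ->
  Ex (fun x => `|iter t av g x|) @[t --> \oo] --> (0 : R).
Proof.
move=> bg g0; apply/cvgrPdist_lt => e e0.
have e20 : 0 < e / 2 by rewrite divr_gt0.
have [n n0 ng] := birk_L1 mtau tauP tauD tau0 erg bg g0 e20.
have nR0 : 0 < n%:R :> R by rewrite ltr0n.
have /L2null_L1/cvgrPdist_lt/(_ (e / 2 * n%:R)) := L2null_birk n bg.
move=> /(_ (mulr_gt0 e20 nR0)); apply: filterS => t.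
rewrite !sub0r !normrN.
rewrite (ger0_norm (Ex_ge0 P (fun x => normr_ge0 (birk _ _ n x - _)))).
rewrite (ger0_norm (Ex_ge0 P (fun x => normr_ge0 (iter t av g x)))) => h.
have bt := bmeas_iter_av t bg.
have bb : bmeas (birk tau (iter t av g) n) by exact: bmeas_birk.
have bd : bmeas (fun x => birk tau (iter t av g) n x - n%:R * iter t av g x).
  by apply: bmeasB => //; apply: bmeasM => //; exact: bmeas_cst.
have : n%:R * Ex (fun x => `|iter t av g x|) <=
    Ex (fun x => `|birk tau (iter t av g) n x - n%:R * iter t av g x|) +
    Ex (fun x => `|birk tau (iter t av g) n x|).
  have i1 := bmeas_int1 P (bmeas_norm bd); have i2 := bmeas_int1 P (bmeas_norm bb).
  have i3 := bmeas_int1 P (bmeas_norm bt).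
  rewrite -ExZ// -ExD//; apply: le_Ex => [||x]; [exact: int1Z|exact: int1D|].
  rewrite -[X in X * _](ger0_norm (ltW nR0)) -normrM distrC.
  by rewrite -{1}[_ * _](subrK (birk tau (iter t av g) n x)) ler_normD.
have : Ex (fun x => `|birk tau (iter t av g) n x|) <= e / 2 * n%:R.
  rewrite -iter_av_birk; apply: le_trans ng; apply: Ex_norm_av.
  by apply: bmeas_int1; exact: bmeas_birk.
move=> h1 h2; rewrite -(ltr_pM2l nR0); lra.
Qed.

(** Clipping [f] to [[-M, M]] gives bounded functions that equal [f] at [x] as soon as [M >= |f x|],
    with error dominated by [|f|]. *)
Lemma truncation f e : int1 f -> 0 < e ->
  exists2 g, bmeas g & Ex (fun x => `|f x - g x|) < e.
Proof.
move=> f1 e0; have mf : measurable_fun setT f.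
  by apply/measurable_EFinP; exact: measurable_int f1.
pose g (M : nat) x := Num.max (- M%:R) (Num.min M%:R (f x)).
have mg M : measurable_fun setT (g M).
  by apply: measurable_maxr => //; exact: measurable_minr.
have gE (M : nat) x : `|f x| <= M%:R -> g M x = f x.
  by rewrite ler_norml /g => /andP[h1 h2]; rewrite min_r// max_r.
have bg M : bmeas (g M).
  split => //; exists M%:R => x; rewrite ler_norml /g le_max lexx/=.
  by rewrite ge_max ge_min lexx/= andbT; have : (0 : R) <= M%:R by []; lra.
have : Ex (fun x => `|f x - g M x|) @[M --> \oo] --> Ex (fun=> 0).
  apply: (@Ex_dominated_cvg _ _ _ _ _ _ (fun x => `|f x|)).
  - by move=> M; apply: measurableT_comp => //; exact: measurable_funB.
  - exact: measurable_cst.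
  - exact: int1_norm.
  - move=> M x; rewrite normr_id.
    have [/gE ->|Mf] := leP `|f x| M%:R; first by rewrite subrr normr0.
    have M0 : (0 : R) <= M%:R by [].
    rewrite /g; case: (ger0P (f x)) Mf => f0 Mf.
      rewrite (min_l (ltW Mf)) max_r; last lra.
      by rewrite ger0_norm; lra.
    rewrite min_r; last lra.
    rewrite max_l; last lra.
    by rewrite ler0_norm; lra.
  apply: nearW => x; apply: cvg_near_cst; exists (Num.truncn `|f x|).+1 => // M /= fM.
  rewrite gE ?subrr ?normr0//; apply: le_trans (ltW (truncnS_gt _)) _.
  by rewrite ler_nat.
rewrite Ex_cst => /cvgrPdist_lt/(_ _ e0)[M _ /(_ M (leqnn M))/=].
by rewrite sub0r normrN ger0_norm; [exists (g M)|apply: Ex_ge0].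
Qed.

(** Contraction in L^1 makes the error of replacing [f] by a bounded [g] uniform in [t]. The errors
    from [f - g], from the centred [g0] and from the two means are each below [e / 4]. *)
Theorem av_L1 f : int1 f ->
  Ex (fun x => `|iter t av f x - Ex f|) @[t --> \oo] --> (0 : R).
Proof.
move=> f1; apply/cvgrPdist_lt => e e0.
have e40 : 0 < e / 4 by rewrite divr_gt0.
have [g bg fg] := truncation f1 e40.
have ig := bmeas_int1 P bg.
pose g0 x := g x + - Ex g.
have bg0 : bmeas g0 by apply: bmeasD => //; exact: bmeas_cst.
have Eg0 : Ex g0 = 0 by rewrite ExD//; [rewrite Ex_cst subrr|exact: int1_cst].
have /cvgrPdist_lt/(_ _ e40) := av_L1_bmeas bg0 Eg0; apply: filterS => t.
rewrite !sub0r !normrN.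
rewrite (ger0_norm (Ex_ge0 P (fun x => normr_ge0 (iter t av g0 x)))).
rewrite (ger0_norm (Ex_ge0 P (fun x => normr_ge0 (iter t av f x - _)))) => h.
have i0 : int1 (fun x => f x - g x) by exact: int1B.
have i1 := int1_norm (int1_iter_av t (bmeas_int1 P bg0)).
have i2 := int1_norm (int1_iter_av t i0).
have fgE : `|Ex g - Ex f| <= Ex (fun x => `|f x - g x|).
  by rewrite distrC -ExB//; apply: le_normr_Rintegral.
have fgt := Ex_norm_av t i0.
have : Ex (fun x => `|iter t av f x - Ex f|) <=
    Ex (fun x => `|iter t av (fun x => f x - g x) x| + `|iter t av g0 x| +
      `|Ex g - Ex f|).
  apply: le_Ex => [||x].
  - apply: int1_norm; apply: int1B; [exact: int1_iter_av|exact: int1_cst].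
  - by apply: int1D; [exact: int1D|exact: int1_cst].
  have -> : iter t av f x - Ex f =
      iter t av (fun x => f x - g x) x + iter t av g0 x + (Ex g - Ex f).
    suff -> : iter t av f x =
        iter t av (fun x => f x - g x) x + iter t av g0 x + Ex g by ring.
    have {1}-> : f = fun x => (f x - g x) + (g0 x + Ex g).
      by apply/funext => y; rewrite /g0; ring.
    rewrite (iter_avD _ (fun x => f x - g x)) (iter_avD _ g0) iter_av_cst.
    by rewrite addrA.
  by apply: le_trans (ler_normD _ _) _; rewrite lerD2r ler_normD.
rewrite ExD; [|exact: int1D|exact: int1_cst]; rewrite ExD// Ex_cst; lra.
Qed.

End averaging.

(** * The stationary process *)

Section walk.
Variables (R : realType) (w : int -> R) (L : {fset int}).
Hypothesis w_out : forall k, k \notin L -> w k = 0.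

Definition smooth (x : int -> R) (i : int) : R := \sum_(k <- L) w k * x (i + k).

Lemma fsum_smooth (x : int -> R) i :
  \sum_(k \in [set: int]) w k * x (i + k) = smooth x i.
Proof. by rewrite (fsbigTE L)// => k /w_out ->; rewrite mul0r. Qed.

Lemma psteps n i j : pstep w n.+1 i j = \sum_(k <- L) w k * pstep w n (i + k) j.
Proof.
rewrite /= (reindex_fsbigT (+%R i)); last first.
  by exists (fun k => k - i) => k; rewrite ?(addrC i) ?addrK ?subrK.
rewrite (fsbigTE L) => [|k kL]; last by rewrite addrC addKr w_out ?mul0r// addrC.
by apply: eq_bigr => k _; rewrite [i + k - i]addrC addKr.
Qed.

Lemma pstep_finite n i : exists A : {fset int}, forall j, j \notin A -> pstep w n i j = 0.
Proof.
elim: n i => [|n IH] i.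
  by exists [fset i]%fset => j; rewrite inE eq_sym => /negPf /= ->.
suff [A AP] : exists A : {fset int},
    forall k j, k \in (L : seq int) -> j \notin A -> pstep w n (i + k) j = 0.
  exists A => j jA; rewrite psteps big1_seq// => k /andP[_ kL].
  by rewrite AP ?mulr0.
elim: (L : seq int) => [|k s [A AP]]; first by exists fset0.
have [B BP] := IH (i + k); exists (A `|` B)%fset => l j.
rewrite !inE negb_or => /orP[/eqP ->|ls] /andP[jA jB]; first exact: BP.
exact: AP.
Qed.

Lemma fsum_pstep n i (x : int -> R) (A : {fset int}) :
  (forall j, j \notin A -> pstep w n i j = 0) ->
  \sum_(j <- A) x j * pstep w n i j = iter n smooth x i.
Proof.
elim: n i A => [|n IH] i A AP.
  have iA : i \in A.
    apply/negPn/negP => /AP /=; rewrite eqxx => /eqP; by rewrite oner_eq0.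
  rewrite (perm_big _ (perm_to_rem iA)) big_cons/= eqxx mulr1 big1_seq ?addr0// => j.
  rewrite (mem_rem_uniq _ (fset_uniq A)) inE => /andP[_ /andP[ji _]].
  by rewrite eq_sym (negPf ji) mulr0.
(* [A] carries only [p^(n+1)(i, .)]; the induction hypothesis needs a set that carries
   [p^n(i + k, .)] for every [k] in [L]. *)
have [B BP] : exists B : {fset int}, (A `<=` B)%fset /\
    forall k j, k \in (L : seq int) -> j \notin B -> pstep w n (i + k) j = 0.
  elim: (L : seq int) => [|k s [B [AB BP]]]; first by exists A.
  have [C CP] := pstep_finite n (i + k); exists (B `|` C)%fset.
  split; first exact: fsubset_trans AB (fsubsetUl _ _).
  move=> l j; rewrite !inE negb_or => /orP[/eqP ->|ls] /andP[jB jC]; first exact: CP.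
  exact: BP.
case: BP => AB BP.
transitivity (\sum_(j <- B) x j * pstep w n.+1 i j).
  rewrite -(fsbigTE A) => [|j /AP ->]; last by rewrite mulr0.
  rewrite (fsbigTE B)// => j jB; rewrite AP ?mulr0//.
  by apply: contra jB; move/fsubsetP: AB; exact.
under eq_bigr => j _ do rewrite psteps mulr_sumr.
rewrite exchange_big/=; apply: eq_big_seq => k kL.
rewrite -(IH _ B) => [|j]; last exact: BP.
by rewrite mulr_sumr; apply: eq_bigr => j _; rewrite mulrCA.
Qed.

Lemma fsum_pstepB n i (x : int -> R) :
  \sum_(j \in [set: int]) x j * (pstep w n i j - pstep w n (i - 1) j) =
  iter n smooth x i - iter n smooth x (i - 1).
Proof.
have [A AP] := pstep_finite n i; have [B BP] := pstep_finite n (i - 1).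
have {}AP j : j \notin (A `|` B)%fset -> pstep w n i j = 0.
  by rewrite inE negb_or => /andP[/AP].
have {}BP j : j \notin (A `|` B)%fset -> pstep w n (i - 1) j = 0.
  by rewrite inE negb_or => /andP[_ /BP].
rewrite -(fsum_pstep x AP) -(fsum_pstep x BP) -sumrB.
rewrite (fsbigTE (A `|` B)%fset) => [|j jAB]; last by rewrite AP// BP// subrr mulr0.
by apply: eq_bigr => j _; rewrite mulrBr.
Qed.

(** A deterministic form of the dynamics, for given initial data and noise. The step from [m'] to
    [m'.+1] uses [noise m'], so the noise index starts at 0. *)
Fixpoint evolve (eta : int -> R) (noise : nat -> int -> R) (m : nat) (i : int) : R :=
  if m is m'.+1
  then smooth (evolve eta noise m') i + noise m' i - noise m' (i - 1)
  else eta i.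

(** Variation of constants for a linear recursion: [k] counts the averagings applied to a noise term
    since it entered. For [m = 0] the sum is empty and the truncated [m.-1] is harmless. *)
Lemma evolveE eta noise m i : evolve eta noise m i = iter m smooth eta i +
  \sum_(0 <= k < m) (iter k smooth (noise (m.-1 - k)%N) i -
                     iter k smooth (noise (m.-1 - k)%N) (i - 1)).
Proof.
elim: m i => [|m IH] i; first by rewrite big_geq// addr0.
have step : smooth (evolve eta noise m) i = iter m.+1 smooth eta i +
    \sum_(0 <= k < m) (iter k.+1 smooth (noise (m.-1 - k)%N) i -
                       iter k.+1 smooth (noise (m.-1 - k)%N) (i - 1)).
  rewrite [LHS]/smooth; under eq_bigr => k _ do rewrite IH mulrDr mulr_sumr.
  rewrite big_split/= exchange_big/=; congr (_ + _); apply: eq_bigr => k _.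
  by rewrite -sumrB; apply: eq_bigr => l _; rewrite mulrBr addrAC.
rewrite [LHS]/= step big_nat_recl// [(m.+1.-1 - 0)%N]subn0.
rewrite -!addrA; congr (_ + _); rewrite addrC -addrA; congr (_ + (_ + _)).
apply: eq_big_nat => k /andP[_ km].
by have -> : (m.-1 - k = m.+1.-1 - k.+1)%N by case: m km {IH step}.
Qed.

End walk.

(** Only the noise of the first [m] steps is assumed measurable. This permits the use of the
    sigma-algebra generated by that noise in [state_section]. *)
Lemma measurable_evolve (R : realType) (w : int -> R) (L : {fset int})
    d (T : measurableType d) (eta : T -> RZ R) (noise : T -> nat -> int -> R) m i :
  measurable_fun setT eta ->
  (forall k j, (k < m)%N -> measurable_fun setT (fun x => noise x k j)) ->
  measurable_fun setT (fun x => evolve w L (eta x) (noise x) m i : R).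
Proof.
move=> meta; elim: m i => [|m IH] i mn; first by move/measurable_RZP : meta; exact.
apply: measurable_funB; last exact: mn.
apply: measurable_funD; last exact: mn.
apply: measurable_sum => k; apply: measurable_funM => //.
by apply: IH => l j lm; apply: mn; exact: ltnW.
Qed.

(** * The stationary process started at time -s *)

Section stationary_process.
Context d (Om : measurableType d) (R : realType) (P : probability Om R).
Variables (w : int -> R) (L : {fset int}) (xi : int -> int -> {RV P >-> R}).
Variable nu : probability (RZ R) R.
Hypothesis w_out : forall k, k \notin L -> w k = 0.
Hypothesis iid_xi : iid xi.
Hypothesis hinv : invariant_measure w xi nu.

(** The product space supplies an initial configuration of law [nu] independent of the noise. *)
Let Q : probability (RZ R * Om)%type R := (nu \x P)%E.

Definition rv (f : RZ R * Om -> R) (mf : measurable_fun setT f) : {RV Q >-> R} :=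
  mfun_Sub (mem_set mf).

Lemma prod_snd B : measurable B -> Q (snd @^-1` B) = P B.
Proof.
move=> mB; rewrite (_ : snd @^-1` B = setT `*` B); last first.
  by apply/seteqP; split => [x ?|x []].
transitivity (nu setT * P B)%E; first exact: product_measure1E.
by rewrite probability_setT mul1e.
Qed.

Lemma prod_fst A : measurable A -> Q (fst @^-1` A) = nu A.
Proof.
move=> mA; rewrite (_ : fst @^-1` A = A `*` setT); last first.
  by apply/seteqP; split => [x ?|x []].
transitivity (nu A * P setT)%E; first exact: product_measure1E.
by rewrite probability_setT mule1.
Qed.

(** Moving the time origin to [a] turns any step of the process into the step from 0 to 1 of which
    [invariant_measure] speaks. *)
Definition shifted_noise (a : int) (t i : int) : {RV Q >-> R} :=
  rv (measurableT_comp (@measurable_funP _ _ _ _ setT (xi (t + a) i)) measurable_snd).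

Lemma iid_shifted_noise a : iid (shifted_noise a).
Proof.
case: iid_xi => ind same; split => [J B mB|t k B mB].
  have hK : cancel (fun tk : int * int => (tk.1 + a, tk.2)) (fun tk => (tk.1 - a, tk.2)).
    by move=> [t k] /=; rewrite addrK.
  have := mutually_independent_comp ind hK J mB => /=.
  rewrite -prod_snd; last first.
    apply: fin_bigcap_measurable => // i _.
    exact: measurable_funPTI.
  rewrite preimage_bigcap => ->; apply: eq_bigr => i _.
  rewrite -prod_snd// -[X in measurable X]setTI; exact: measurable_funP.
rewrite /distribution /pushforward.
have snd1 t' k' : Q (shifted_noise a t' k' @^-1` B) = P (xi (t' + a) k' @^-1` B).
  rewrite -prod_snd// -[X in measurable X]setTI; exact: measurable_funP.
by rewrite !snd1; exact: etrans (same _ _ _ mB) (esym (same _ _ _ mB)).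
Qed.

Lemma future_shifted_noise a F : future_sigma (shifted_noise a) F ->
  exists2 F0, <<s gens (fun tk : int * int => xi tk.1 tk.2) [set tk | a < tk.1] >> F0 &
    F = snd @^-1` F0.
Proof.
move=> sF; pose G := gens (fun tk : int * int => xi tk.1 tk.2) [set tk | a < tk.1].
suff sub : future_sigma (shifted_noise a) `<=`
    preimage_set_system setT (@snd (RZ R) Om) <<s G >>.
  by have [F0 sF0 <-] := sub _ sF; exists F0 => //; rewrite setTI.
apply: smallest_sub.
  by apply: sigma_algebra_preimage; exact: smallest_sigma_algebra.
move=> _ [k [i [B [k1 mB ->]]]].
exists (xi (k + a) i @^-1` B); last by rewrite setTI.
apply: sub_sigma_algebra; exists (k + a, i), B; split => //=.
by rewrite ltrDr (lt_le_trans _ k1).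
Qed.

Variable s : nat.

(* The process is started at time [- s], so that its [s]-th step uses the noise
   of time 0 and [state s] contains [Delta0_partial s] itself, not just a copy
   in law (see [state_Delta0]). *)
Definition past_noise (om : Om) (m : nat) (i : int) : R := xi (m.+1%:Z - s%:Z) i om.

Definition state (m : nat) (z : RZ R * Om) : RZ R := evolve w L z.1 (past_noise z.2) m.

Lemma measurable_state m : measurable_fun setT (state m).
Proof.
apply/measurable_RZP => i; apply: measurable_evolve; first exact: measurable_fst.
by move=> k j _; apply: measurableT_comp measurable_snd; exact: measurable_funP.
Qed.

(** With [eta] frozen, the state is a function of the noise up to time [m - s]. Measurability is
    checked with [Om] carrying just the sigma-algebra of that noise. *)
Lemma state_section m eta A : measurable A ->
  <<s gens (fun tk : int * int => xi tk.1 tk.2) [set tk | tk.1 <= m%:Z - s%:Z] >>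
  ((fun om => state m (eta, om)) @^-1` A).
Proof.
move=> mA.
pose G := gens (fun tk : int * int => xi tk.1 tk.2) [set tk | tk.1 <= m%:Z - s%:Z].
have : measurable_fun setT
    ((fun om => state m (eta, om)) : g_sigma_algebraType G -> RZ R).
  apply/measurable_RZP => i; apply: measurable_evolve; first exact: measurable_cst.
  move=> k j km _ B mB; rewrite setTI; apply: sub_sigma_algebra.
  exists (k.+1%:Z - s%:Z, j), B; split => //=.
  by rewrite lerB// lez_nat.
by move=> /(_ measurableT A mA); rewrite setTI.
Qed.

(** For each fixed initial configuration, the state depends on noise up to time [m - s] and [F] on
    later noise, so the sections are independent. Integrating over the configuration gives the
    claim. *)
Lemma state_indep m A F : measurable A -> future_sigma (shifted_noise (m%:Z - s%:Z)) F ->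
  Q (state m @^-1` A `&` F) = (Q (state m @^-1` A) * Q F)%E.
Proof.
move=> mA /future_shifted_noise[F0 sF0 ->].
have mF0 : measurable F0.
  move: F0 sF0; apply: smallest_sub; first exact: sigma_algebra_measurable.
  move=> _ [tk [B [_ mB ->]]]; exact: measurable_funPTI.
have mE : measurable (state m @^-1` A).
  by rewrite -[X in measurable X]setTI; exact: measurable_state.
rewrite prod_snd// /Q /= /product_measure1.
rewrite muleC -ge0_integralZl//; last exact: measurable_fun_xsection.
apply: eq_integral => eta _ /=.
rewrite muleC -(@gens_indep _ _ _ _ _ _ (proj1 iid_xi)
  [set tk | tk.1 <= m%:Z - s%:Z] [set tk | m%:Z - s%:Z < tk.1])//.
- congr (P _); apply/seteqP; split => om; rewrite /xsection/= ?inE//.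
- by apply/seteqP; split => // tk [] /= h1 h2; have := le_lt_trans h1 h2; rewrite ltxx.
- rewrite (_ : xsection _ _ = (fun om => state m (eta, om)) @^-1` A).
    exact: state_section.
  by apply/seteqP; split => om; rewrite /xsection/= ?inE.
Qed.

(** Invariance is applied once per step, with the current state as initial configuration and the
    noise restarted at time [m - s]. *)
Lemma state_law m A : measurable A -> Q (state m @^-1` A) = nu A.
Proof.
elim: m A => [|m IH] A mA; first exact: prod_fst.
pose eta0 : {RV Q >-> RZ R} := mfun_Sub (mem_set (measurable_state m)).
have same B : measurable B ->
    distribution Q (shifted_noise (m%:Z - s%:Z) 0 0) B = distribution P (xi 0 0) B.
  move=> mB; case: iid_xi => _ /(_ (0 + (m%:Z - s%:Z)) 0 B mB) <-.
  by rewrite /distribution /pushforward -prod_snd//; exact: measurable_funPTI.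
have := hinv (iid_shifted_noise (m%:Z - s%:Z)) same (eta0 := eta0).
move=> /(_ (@state_indep m) IH A mA) <-.
have stateS : state m.+1 =
    increment w (fun t i => shifted_noise (m%:Z - s%:Z) t i) eta0 1.
  apply/funext => z; apply/funext => i.
  have mE : m.+1%:Z - s%:Z = 1%:Z + (m%:Z - s%:Z) by rewrite addrA -PoszD add1n.
  by rewrite /= (fsum_smooth w_out) -mE.
by rewrite stateS.
Qed.

End stationary_process.

(** * Passage to the limit *)

Section convergence_in_probability.
Context d (T : measurableType d) (R : realType) (P : probability T R).

Lemma measurable_tail (f : T -> R) (e : R) : measurable_fun setT f ->
  measurable [set x | e < `|f x|].
Proof.
move=> mf; rewrite (_ : [set x | _] = (fun x => `|f x|) @^-1` `]e, +oo[); last first.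
  by apply/seteqP; split => x; rewrite /= in_itv/= andbT.
by rewrite -[X in measurable X]setTI; apply: measurableT_comp.
Qed.

Lemma tail_cvg0 (f_ : nat -> T -> R) (e : R) :
  (forall n, measurable_fun setT (f_ n)) -> 0 < e ->
  (\int[P]_x (`|f_ n x|%:E))%E @[n --> \oo] --> 0%E ->
  P [set x | e < `|f_ n x|] @[n --> \oo] --> 0%E.
Proof.
move=> mf e0 f0.
apply: (squeeze_cvge (f := fun=> 0%E)
  (h := fun n => (e^-1%:E * \int[P]_x (`|f_ n x|%:E))%E)).
- apply: nearW => n; pose E := [set x | e < `|f_ n x|].
  rewrite -/E measure_ge0/= lee_pdivlMl//.
  have mE : measurable E by exact: measurable_tail.
  have <- : (\int[P]_(x in E) (e%:E) = e%:E * P E)%E.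
    exact: integral_cst.
  apply: (@le_trans _ _ (\int[P]_(x in E) (`|f_ n x|%:E))%E).
    apply: ge0_le_integral => //.
    + by move=> x _; rewrite lee_fin ltW.
    + by apply/measurable_EFinP; apply: measurable_funTS; exact: measurableT_comp.
    + by move=> x /ltW; rewrite lee_fin.
  apply: ge0_subset_integral => //.
  by apply/measurable_EFinP; exact: measurableT_comp.
- exact: cvg_cst.
- by rewrite -[X in _ --> X](mule0 e^-1%:E); apply: cvgeZl.
Qed.

Definition fatten (l : seq (int * R)) (e : R) := [seq (t.1, t.2 + e) | t <- l].

(** The fattened orthants for [e = 1 / (n + 1)] decrease to the orthant itself, because its
    inequalities are not strict; continuity of [m2] from above concludes. *)
Lemma orthant_fatten_le (m1 m2 : probability (RZ R) R) l :
  (forall e, 0 < e -> (m1 (orthant l) <= m2 (orthant (fatten l e)))%E) ->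
  (m1 (orthant l) <= m2 (orthant l))%E.
Proof.
move=> m12.
have lE : orthant l = \bigcap_n orthant (fatten l n.+1%:R^-1).
  apply/seteqP; split => [x xl n _ _ /mapP[t tl ->]/=|x xl t tl].
    by apply: le_trans (xl t tl) _; rewrite lerDl.
  apply/ler_addgt0Pr => e e0.
  pose n := Num.truncn e^-1.
  have := xl n I (t.1, t.2 + n.+1%:R^-1).
  move=> /(_ (map_f _ tl))/= h; apply: le_trans h _; rewrite lerD2l.
  by rewrite invf_ple ?posrE// ltW// truncnS_gt.
set F := fun n : nat => orthant (fatten l n.+1%:R^-1).
have mF n : measurable (F n) by exact: measurable_orthant.
have cvF : (m2 \o F) @ \oo --> m2 (\bigcap_n F n).
  apply: nonincreasing_cvg_mu => //.
  - by rewrite -ge0_fin_numE// fin_num_measure.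
  - exact: bigcapT_measurable.
  move=> n m nm; apply/subsetPset => x xm _ /mapP[t tl ->]/=.
  apply: le_trans (xm (t.1, t.2 + m.+1%:R^-1) (map_f _ tl)) _.
  by rewrite /= lerD2l lef_pV2 ?posrE// ler_nat ltnS.
rewrite [X in m2 X]lE -(cvg_lim _ cvF)//; apply: lime_ge; first exact: cvgP cvF.
by apply: nearW => n /=; exact: m12.
Qed.

(** Off the event that [X] and [Y] differ by more than [e] at some listed site, bounds on [X] become
    bounds on [Y] relaxed by [e]; the sum is the union bound. *)
Lemma orthant_close (X Y : T -> RZ R) l e : measurable_fun setT X ->
  measurable_fun setT Y ->
  (P (X @^-1` orthant l) <= P (Y @^-1` orthant (fatten l e)) +
    \sum_(t <- l) P [set x | (e < `|X x t.1 - Y x t.1|)%R])%E.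
Proof.
move=> mX mY.
have mi (Z : T -> RZ R) s : measurable_fun setT Z -> measurable (Z @^-1` orthant s).
  by move=> mZ; rewrite -[X in measurable X]setTI; apply: mZ => //;
    exact: measurable_orthant.
have mt i : measurable [set x | e < `|X x i - Y x i|].
  apply: measurable_tail; by apply: measurable_funB; apply: (measurable_RZP _).1.
pose bad (s : seq (int * R)) := \big[setU/set0]_(t <- s) [set x | e < `|X x t.1 - Y x t.1|].
have mbad s : measurable (bad s) by apply: bigsetU_measurable.
have Pbad s : (P (bad s) <= \sum_(t <- s) P [set x | (e < `|X x t.1 - Y x t.1|)%R])%E.
  elim: s => [|t s IH]; rewrite /bad ?big_nil ?measure0// !big_cons.
  by apply: le_trans (measureU2 _ _ _) _ => //; [exact: mbad|exact: leeD2l].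
apply: (@le_trans _ _ (P (Y @^-1` orthant (fatten l e) `|` bad l))).
  apply: le_measure; rewrite ?inE; [exact: mi|by apply: measurableU => //; exact: mi|].
  move=> x /= Xl; have [xb|xb] := pselect (bad l x); [by right|left].
  move=> _ /mapP[t tl ->]/=; apply: le_trans (lerD (Xl t tl) (lexx e)).
  rewrite leNgt; apply/negP => h; apply: xb.
  rewrite /bad -bigcup_seq; exists t => //=.
  by rewrite distrC; apply: lt_le_trans (ler_norm _); rewrite ltrBrDl.
by apply: le_trans (measureU2 _ _ _) _ => //; [exact: mi|apply: leeD2l; exact: Pbad].
Qed.

Lemma cvg_sum0 (l : seq (int * R)) (u : int -> nat -> \bar R) :
  (forall i, u i n @[n --> \oo] --> 0%E) ->
  (\sum_(t <- l) u t.1 n)%E @[n --> \oo] --> 0%E.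
Proof.
move=> u0; elim: l => [|t l IH].
  rewrite (_ : (fun n => _) = fun=> 0%E); first exact: cvg_cst.
  by apply/funext => n; rewrite big_nil.
rewrite (_ : (fun n => _) = fun n => u t.1 n + \sum_(t <- l) u t.1 n)%E; last first.
  by apply/funext => n; rewrite big_cons.
suff : (fun n => u t.1 n + \sum_(t <- l) u t.1 n)%E @ \oo --> (0 + 0)%E by rewrite adde0.
by apply: cvgeD.
Qed.

(** Both laws are compared on orthants. Since every [X n] has law [nu], [orthant_close] used in both
    directions at a suitable [n] gives the two inequalities up to fattening and an arbitrarily small
    error. *)
Lemma law_of_limit (nu : probability (RZ R) R) (X : nat -> T -> RZ R) (Y : T -> RZ R) :
  (forall n, measurable_fun setT (X n)) -> measurable_fun setT Y ->
  (forall n A, measurable A -> P (X n @^-1` A) = nu A) ->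
  (forall i e, 0 < e -> P [set x | e < `|X n x i - Y x i|] @[n --> \oo] --> 0%E) ->
  forall A, measurable A -> nu A = P (Y @^-1` A).
Proof.
move=> mX mY Xnu XY.
pose Y' : {RV P >-> RZ R} := mfun_Sub (mem_set mY).
apply: (@orthant_unique _ nu (distribution P Y')) => [|l].
  by rewrite -ge0_fin_numE// fin_num_measure.
have small e d' : 0 < e -> 0 < d' -> exists n,
    (\sum_(t <- l) P [set x | (e < `|X n x t.1 - Y x t.1|)%R] <= d'%:E)%E.
  move=> e0 d0; have := cvg_sum0 l (fun i => XY i e e0).
  move=> /fine_cvgP[+ /cvgrPdist_lt/(_ _ d0)] => -[N1 _ h1] [N2 _ h2].
  exists (maxn N1 N2); rewrite -[leLHS]fineK; last by apply: h1; rewrite /= leq_maxl.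
  have /ltW := h2 (maxn N1 N2) (leq_maxr _ _).
  rewrite sub0r normrN lee_fin; apply: le_trans; exact: ler_norm.
apply/eqP; rewrite eq_le; apply/andP; split; apply: orthant_fatten_le => e e0;
  apply/lee_addgt0Pr => d' d0; have [n nd] := small e d' e0 d0.
- rewrite -(Xnu n); last exact: measurable_orthant.
  apply: le_trans (orthant_close l e (mX n) mY) _.
  exact: leeD2l.
- rewrite -(Xnu n); last exact: measurable_orthant.
  apply: le_trans (orthant_close l e mY (mX n)) _.
  apply: leeD2l; apply: le_trans nd.
  by under eq_bigr do under eq_set do rewrite distrC.
Qed.

End convergence_in_probability.

(** * Spatial shifts of configurations *)

Section shift_action.
Context (R : realType) (nu : probability (RZ R) R).

Lemma thetaD k l (x : RZ R) : theta (k + l) x = theta k (theta l x).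
Proof. by apply/funext => i; rewrite /theta addrA. Qed.

Lemma theta0 (x : RZ R) : theta 0 x = x.
Proof. by apply/funext => i; rewrite /theta addr0. Qed.

Lemma measurable_theta k : measurable_fun setT (@theta R k).
Proof. by apply/measurable_RZP => i; exact: measurable_coord. Qed.

(** Shift invariance and ergodicity are stated with images, the ergodic theorem with preimages;
    [theta k] is a bijection with inverse [theta (- k)]. *)
Lemma theta_preimage k A : @theta R k @^-1` A = theta (- k) @` A.
Proof.
apply/seteqP; split => [x xA|_ [x xA <-]] /=.
  by exists (theta k x) => //; rewrite -thetaD addNr theta0.
by rewrite -thetaD subrr theta0.
Qed.

Lemma shift_invariant_preimage : shift_invariant nu ->
  forall k A, measurable A -> nu (@theta R k @^-1` A) = nu A.
Proof. by move=> h k A mA; rewrite theta_preimage h. Qed.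

Lemma shift_ergodic_preimage : shift_ergodic nu ->
  forall B, measurable B -> (forall k, @theta R k @^-1` B = B) ->
  nu B = 0%E \/ nu B = 1%E.
Proof.
by move=> h B mB tB; apply: h => // k; rewrite -[k]opprK -theta_preimage.
Qed.

(** [av] acts on functions of a configuration and [smooth] on the configuration itself; the
    induction closes because [smooth] commutes with shifts. *)
Lemma iter_av_coord (L : {fset int}) (w : int -> R) t i (x : RZ R) :
  iter t (av (@theta R) L w) (fun y : RZ R => y i) x = iter t (smooth w L) x i.
Proof.
have smooth_theta k n (y : RZ R) j :
    iter n (smooth w L) (theta k y) j = iter n (smooth w L) y (j + k).
  elim: n j => //= n IH j; apply: eq_bigr => l _.
  by rewrite IH addrAC.
elim: t x => //= t IH x; apply: eq_bigr => k _.
by rewrite IH smooth_theta.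
Qed.

End shift_action.

(** * Convergence at time 0 and identification of the law *)

Lemma state_Delta0 d (Om : measurableType d) (R : realType) (P : probability Om R)
    (w : int -> R) (L : {fset int}) (xi : int -> int -> {RV P >-> R}) s z i :
  (forall k, k \notin L -> w k = 0) ->
  state w L xi s s z i = iter s (smooth w L) z.1 i + Delta0_partial w xi s i z.2.
Proof.
move=> w_out; rewrite /state evolveE; congr (_ + _); apply: eq_big_nat => k /andP[_ ks].
rewrite (fsum_pstepB w_out k i (fun j => xi (- k%:Z) j z.2)).
suff -> : past_noise xi s z.2 (s.-1 - k) = fun j => xi (- k%:Z) j z.2 by [].
apply/funext => j; rewrite /past_noise; congr (xi _ j z.2).
(* Noise index [s.-1 - k] means time [(s.-1 - k).+1 - s = - k]; the truncated subtraction is exact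
   because [k < s]. *)
have -> : (s.-1 - k).+1 = (s - k)%N by case: s ks => // s ks; rewrite /= subSn.
by rewrite -subzn 1?ltnW// addrAC subrr add0r.
Qed.

(** This is [av_L1] for the coordinate [i], whose mean equals that of coordinate 0 by shift
    invariance. *)
Lemma cvg_smooth (R : realType) (w : int -> R) (L : {fset int})
    (nu : probability (RZ R) R) c :
  (forall k, 0 <= w k) -> \sum_(k <- L) w k = 1 -> (forall k, supp w k -> k \in L) ->
  W2 w -> shift_invariant nu -> shift_ergodic nu ->
  ('E_nu[fun eta : RZ R => `|eta 0|%R] < +oo)%E ->
  ('E_nu[fun eta : RZ R => (eta 0)%R] = c%:E)%E ->
  forall i, (\int[nu]_x (`|iter t (smooth w L) x i - c|%R%:E))%E @[t --> \oo] --> 0%E.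
Proof.
move=> w0 w1 suppL span1 sinv serg hint hmean i.
have tauP := shift_invariant_preimage sinv.
have serg' := shift_ergodic_preimage serg.
pose ev j (x : RZ R) : R := x j.
have ev1 : int1 nu (ev 0).
  apply/integrableP; split; first by apply/measurable_EFinP; exact: measurable_coord.
  by move: hint; rewrite unlock.
have Eev0 : Ex nu (ev 0) = c by rewrite /Ex/Rintegral; move: hmean; rewrite unlock => ->.
have evi : ev i = fun x => ev 0 (theta i x).
  by apply/funext => x; rewrite /ev /theta add0r.
have i1 : int1 nu (ev i) by rewrite evi; exact: (int1_tau (@measurable_theta R) tauP).
have Eevi : Ex nu (ev i) = c.
  by rewrite evi (Ex_tau (@measurable_theta R) tauP)//.
have := av_L1 (@measurable_theta R) tauP (@thetaD R) (@theta0 R) serg' w0 w1 suppL span1 i1.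
rewrite Eevi => cv.
rewrite (_ : (fun t => _) =
  fun t => (Ex nu (fun x => `|iter t (av (@theta R) L w) (ev i) x - c|))%:E).
  by apply: cvg_EFin => //; exact: nearW.
apply/funext => t; rewrite fineK.
  by apply: eq_integral => x _; rewrite iter_av_coord.
apply: integrable_fin_num => //; apply: int1_norm; apply: int1B; last exact: int1_cst.
exact: (int1_iter_av (@measurable_theta R) tauP).
Qed.

Theorem theorem2p13 (R : realType) (w : int -> R)
    (d : measure_display) (Om : measurableType d) (P : probability Om R)
    (xi : int -> int -> {RV P >-> R})
    (hW1 : W1 w) (hW2 : W2 w) (hX : assumption_X xi)
    (Delta0 : int -> {RV P >-> R}) (hDelta0 : is_Delta0 w xi Delta0)
    (nu : probability (RZ R) R) (c : R)
    (hinv : invariant_measure w xi nu)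
    (hshift : shift_invariant nu)
    (herg : shift_ergodic nu)
    (hint : ('E_nu[fun eta : RZ R => `|eta 0|%R] < +oo)%E)
    (hmean : ('E_nu[fun eta : RZ R => (eta 0)%R] = c%:E)%E) :
  forall A : set (RZ R), measurable A -> nu A = pi_ Delta0 c A.
Proof.
case: hW1 => w01 w1 supp_fin.
pose L := fset_set (supp w).
have w0 k : 0 <= w k by case/andP: (w01 k).
have suppL k : supp w k -> k \in L by move=> sk; rewrite in_fset_set// inE.
have w_out k : k \notin L -> w k = 0.
  move=> kL; apply/eqP/negPn/negP => wk; move/negP: kL; apply; apply: suppL.
  by rewrite /supp/= lt_def wk w0.
have wL : \sum_(k <- L) w k = 1 by rewrite -w1 (fsbigTE L).
have iid_xi := proj1 hX.
pose Q : probability (RZ R * Om)%type R := (nu \x P)%E.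
pose Y (z : RZ R * Om) : RZ R := fun i => c + Delta0 i z.2.
have mD i : measurable_fun setT (Delta0 i) by [].
have mDelta : measurable_fun setT (fun om => (fun i => c + Delta0 i om) : RZ R).
  by apply/measurable_RZP => i; apply: measurable_funD.
have mY : measurable_fun setT Y := measurableT_comp mDelta measurable_snd.
move=> A mA.
(* The approximants are the states at time 0 of the processes started at time [- s]. All have law
   [nu], and they converge to [Y] in probability. *)
rewrite (@law_of_limit _ _ _ Q nu (fun s => state w L xi s s) Y _ mY _ _ A mA).
- rewrite /pi_/pushforward -(@prod_snd _ _ _ P nu)//.
  by rewrite -[X in measurable X]setTI; exact: mDelta.
- by move=> s; exact: measurable_state.
- by move=> s B mB; exact: (state_law w_out iid_xi hinv).
move=> i e e0.
have e20 : 0 < e / 2 by rewrite divr_gt0.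
pose a s (x : RZ R) : R := iter s (smooth w L) x i - c.
pose b s om : R := Delta0_partial w xi s i om - Delta0 i om.
have ms s j : measurable_fun setT (fun x : RZ R => iter s (smooth w L) x j : R).
  elim: s j => [|s IH] j /=; first exact: measurable_coord.
  by apply: measurable_sum => k; apply: measurable_funM.
have ma s : measurable_fun setT (a s) by apply: measurable_funB.
have mb s : measurable_fun setT (b s).
  apply: measurable_funB => //; apply: measurable_sum => k.
  under eq_fun do rewrite (fsum_pstepB w_out k i (fun j => xi (- k%:Z) j _)).
  have mx j :
      measurable_fun setT (fun om => iter k (smooth w L) (fun j => xi (- k%:Z) j om) j).
    elim: (k in iter k) j => [|n IH] j //=.
    by apply: measurable_sum => l; apply: measurable_funM.
  exact: measurable_funB.
have cva := tail_cvg0 ma e20 (cvg_smooth w0 wL suppL hW2 hshift herg hint hmean i).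
have cvb : P [set om | e / 2 < `|b s om|] @[s --> \oo] --> 0%E.
  have mb2 s : measurable_fun setT (fun om => b s om ^+ 2) by exact: measurable_funX.
  have e220 : 0 < (e / 2) ^+ 2 by rewrite exprn_gt0.
  (* The L^2 convergence to [Delta0] enters through Markov's inequality for the square, at level
     [(e / 2) ^+ 2]. *)
  have := @tail_cvg0 _ _ _ P (fun s om => b s om ^+ 2) _ mb2 e220.
  rewrite (_ : (fun s => P _) = fun s => P [set om | e / 2 < `|b s om|]); last first.
    apply/funext => s; congr (P _); apply/seteqP; split => om /=;
    by rewrite normrX ltr_pXn2r// nnegrE// ltW.
  apply; have [_ cvD] := hDelta0 i.
  rewrite (_ : (fun s => _) = fun s => 'E_P[fun om => (b s om ^+ 2)%R]%E)//.
  apply/funext => s; rewrite unlock; apply: eq_integral => om _.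
  by rewrite ger0_norm// sqr_ge0.
(* The error at time 0 is the sum of [a s], a function of the initial configuration, and [b s], a
   function of the noise. If it exceeds [e] in absolute value, one of them exceeds [e / 2], and each
   probability is read off a marginal of [Q]. *)
apply: (squeeze_cvge (f := fun=> 0%E)
  (h := fun s => (nu [set x | (e / 2 < `|a s x|)%R] + P [set om | (e / 2 < `|b s om|)%R])%E)).
- apply: nearW => s; rewrite measure_ge0/=.
  have mA' := measurable_tail (e / 2) (ma s); have mB' := measurable_tail (e / 2) (mb s).
  have mA'' : measurable (@fst (RZ R) Om @^-1` [set x | e / 2 < `|a s x|]).
    by rewrite -[X in measurable X]setTI; apply: measurable_fst.
  have mB'' : measurable (@snd (RZ R) Om @^-1` [set x | e / 2 < `|b s x|]).
    by rewrite -[X in measurable X]setTI; apply: measurable_snd.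
  rewrite -(@prod_fst _ _ _ P nu _ mA') -(@prod_snd _ _ _ P nu _ mB').
  apply: le_trans (measureU2 _ mA'' mB''); apply: le_measure; rewrite ?inE.
  + apply: measurable_tail; apply: measurable_funB; last exact: (measurable_RZP Y).1.
    by apply: (measurable_RZP (state w L xi s s)).1; exact: measurable_state.
  + exact: measurableU.
  move=> z /=; rewrite (state_Delta0 _ _ _ _ w_out) /Y => h.
  have [?|az] := ltP (e / 2) `|a s z.1|; [by left|right].
  rewrite ltNge; apply/negP => bz; move: h; apply/negP; rewrite -leNgt.
  have -> : iter s (smooth w L) z.1 i + Delta0_partial w xi s i z.2 -
    (c + Delta0 i z.2) = a s z.1 + b s z.2 by rewrite /a/b; ring.
  by apply: le_trans (ler_normD _ _) _; rewrite [leRHS](splitr e) lerD.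
- exact: cvg_cst.
- by rewrite -[X in _ --> X](adde0 0%E); apply: cvgeD.
Qed.
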